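(* Let $q=p^e$ with $p$ an odd prime and $e\ge2$. Let $f\in\mathcal{RF}$ with $\varepsilon\in\{\pm1\}$ the sign of its Walsh transform, and let $$\mathcal{C}_f=\{(af(x)+\mathrm{Tr}_{q/p}(bx)+c)_{x\in\mathbb{F}_q}: a\in\mathbb{F}_p,\ b\in\mathbb{F}_q,\ c\in\mathbb{F}_p\}.$$ Then $\mathcal{C}_f$ is a $[q,e+2]$ linear code over $\mathbb{F}_p$ with the following weight distribution. If $e$ is even: weight $0$ with frequency $1$; weight $p^e-p^{e-1}-\frac{\varepsilon(p-1)\sqrt{p^*}^e}{p}$ with frequency $(p-1)p^e$; weight $p^e-p^{e-1}+\frac{\varepsilon\sqrt{p^*}^e}{p}$ with frequency $(p-1)^2p^e$; weight $p^e-p^{e-1}$ with frequency $p(p^e-1)$; weight $p^e$ with frequency $p-1$. If $e$ is odd: weight $0$ with frequency $1$; weight $p^e-p^{e-1}-\frac{\varepsilon\sqrt{p^*}^eG(\eta_0,\lambda_1)}{p}$ with frequency $\frac{(p-1)^2p^e}{2}$; weight $p^e-p^{e-1}+\frac{\varepsilon\sqrt{p^*}^eG(\eta_0,\lambda_1)}{p}$ with frequency $\frac{(p-1)^2p^e}{2}$; weight $p^e-p^{e-1}$ with frequency $2p^{e+1}-p^e-p$; weight $p^e$ with frequency $p-1$. In particular, $\mathcal{C}_f$ is self-orthogonal for $e\ge3$. Moreover, if $e=2$ and $\varepsilon\eta_0(-1)=-1$, then $\mathcal{C}_f^{\perp}$ is an almost MDS code with parameters $[q,q-4,4]$, optimal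 according to the sphere-packing bound; in all other cases $\mathcal{C}_f^{\perp}$ has parameters $[q,q-e-2,3]$ and is at least almost optimal according to the sphere-packing bound.
   Context: $\zeta_p=e^{2\pi i/p}$; $\mathrm{Tr}_{q/p}$ is the trace map from $\mathbb{F}_q$ to $\mathbb{F}_p$. $p^*=(-1)^{(p-1)/2}p$, and $\sqrt{p^*}$ denotes $\sqrt p$ if $p\equiv1\pmod4$ and $\sqrt{-1}\sqrt p$ if $p\equiv3\pmod4$. $\eta_0$ is the quadratic character of $\mathbb{F}_p$, $\lambda_1(y)=\zeta_p^{y}$ the canonical additive character of $\mathbb{F}_p$, and $G(\eta_0,\lambda_1)=\sum_{y\in\mathbb{F}_p^*}\eta_0(y)\zeta_p^y=\sqrt{-1}^{((p-1)/2)^2}\sqrt p$. For $f:\mathbb{F}_{p^e}\to\mathbb{F}_p$, the Walsh transform is $W_f(\beta)=\sum_{x\in\mathbb{F}_{p^e}}\zeta_p^{f(x)-\mathrm{Tr}_{p^e/p}(\beta x)}$; $f$ is weakly regular bent if there are $\varepsilon\in\{\pm1\}$ (the sign of the Walsh transform) and a function $f^*:\mathbb{F}_{p^e}\to\mathbb{F}_p$ (the dual) with $W_f(\beta)=\varepsilon\sqrt{p^*}^e\zeta_p^{f^*(\beta)}$ for all $\beta$. $\mathcal{RF}$ is the set of weakly regular bent $f$ with $f(0)=0$ and $f(ax)=a^hf(x)$ for all $a\in\mathbb{F}_p^*$, $x\in\mathbb{F}_{p^e}$, for some positive even integer $h$ with $\gcd(h-1,p-1)=1$. An almost MDS code is an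 $[n,k,n-k]$ code. Optimal: no $[n,k,d+1]$ code exists; almost optimal: an optimal $[n,k,d+1]$ code exists; ''at least almost optimal according to the sphere-packing bound'' means the sphere-packing bound rules out an $[n,k,d+2]$ code, and ''optimal according to the sphere-packing bound'' that it rules out an $[n,k,d+1]$ code. *)

(* Defs.v *)
From HB Require Import structures.
From mathcomp Require Import all_boot all_order all_algebra all_field.
Import Order.TTheory GRing.Theory Num.Theory.
Local Open Scope ring_scope.

(* zeta_p = e^{2 pi i / p}: p.-root (-1) is the p-th root of -1 with minimal
   nonnegative argument, i.e. e^{i pi / p}; its square is e^{2 pi i / p}. *)
Definition zeta (p : nat) : algC := (nthroot p (-1)) ^+ 2.

Definition sqrt_pstar (p : nat) : algC :=
  if (p %% 4 == 1)%N then sqrtC (p%:R) else 'i * sqrtC (p%:R).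

Definition eta0 (p : nat) (y : 'F_p) : algC :=
  if y == 0 then 0 else if [exists z : 'F_p, z ^+ 2 == y] then 1 else -1.

Definition gauss_eta0 (p : nat) : algC :=
  \sum_(y : 'F_p | y != 0) eta0 p y * zeta p ^+ (nat_of_ord y).

(* absolute trace Tr_{p^e/p}(x) = sum_{i<e} x^(p^i), viewed in F_p through the
   identification of F_p with the prime subfield {n * 1} of F. *)
Definition trace (p e : nat) (F : finFieldType) (x : F) : 'F_p :=
  odflt 0 [pick a : 'F_p | (nat_of_ord a)%:R == \sum_(i < e) x ^+ (p ^ i)].

Definition walsh (p e : nat) (F : finFieldType) (f : F -> 'F_p) (beta : F) : algC :=
  \sum_(x : F) zeta p ^+ (nat_of_ord (f x - trace p e F (beta * x))).

Definition weakly_regular_bent (p e : nat) (F : finFieldType) (f : F -> 'F_p)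
    (eps : algC) : Prop :=
  (eps = 1 \/ eps = -1) /\
  exists fstar : F -> 'F_p, forall beta : F,
    walsh p e F f beta = eps * sqrt_pstar p ^+ e * zeta p ^+ (nat_of_ord (fstar beta)).

Definition in_RF (p e : nat) (F : finFieldType) (f : F -> 'F_p) : Prop :=
  (exists eps : algC, weakly_regular_bent p e F f eps) /\
  f 0 = 0 /\
  exists h : nat, [/\ (0 < h)%N, ~~ odd h, coprime (h - 1) (p - 1) &
    forall (a : 'F_p) (x : F), a != 0 ->
      f ((nat_of_ord a)%:R * x) = a ^+ h * f x].

Definition word (p : nat) (F : finFieldType) := {ffun F -> 'F_p}.

Definition zero_word (p : nat) (F : finFieldType) : word p F := [ffun => 0].

Definition wt (p : nat) (F : finFieldType) (c : word p F) : nat :=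
  #|[set x | c x != 0]|.

Definition dot (p : nat) (F : finFieldType) (u v : word p F) : 'F_p :=
  \sum_(x : F) u x * v x.

Definition dual_code (p : nat) (F : finFieldType) (C : {set word p F})
  : {set word p F} :=
  [set v | [forall u in C, dot p F u v == 0]].

Definition is_linear_code (p : nat) (F : finFieldType) (C : {set word p F}) : Prop :=
  zero_word p F \in C /\
  forall (k : 'F_p) (u v : word p F), u \in C -> v \in C ->
    [ffun x => k * u x + v x] \in C.

(* minimum distance (= minimum nonzero weight, for a linear code) *)
Definition min_dist (p : nat) (F : finFieldType) (C : {set word p F}) (d : nat)
  : Prop :=
  (exists2 c, c \in C & c != zero_word p F /\ wt p F c = d) /\
  forall c, c \in C -> c != zero_word p F -> (d <= wt p F c)%N.

(* C is an [n, k] linear code over F_p (dimension k <=> p^k codewords) *)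
Definition is_nk_code (p : nat) (F : finFieldType) (C : {set word p F}) (n k : nat)
  : Prop :=
  [/\ is_linear_code p F C, #|F| = n & #|C| = (p ^ k)%N].

Definition is_nkd_code (p : nat) (F : finFieldType) (C : {set word p F})
    (n k d : nat) : Prop :=
  is_nk_code p F C n k /\ min_dist p F C d.

Definition almost_MDS (p : nat) (F : finFieldType) (C : {set word p F}) : Prop :=
  exists n k, is_nkd_code p F C n k (n - k).

Definition sphere_packing_ok (p n k d : nat) : bool :=
  (p ^ k * (\sum_(i < ((d - 1)./2).+1) 'C(n, i) * (p - 1) ^ i) <= p ^ n)%N.

Definition freq (p : nat) (F : finFieldType) (C : {set word p F}) (w : algC) : nat :=
  #|[set c in C | (wt p F c)%:R == w]|.

Definition code_Cf (p e : nat) (F : finFieldType) (f : F -> 'F_p)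
  : {set word p F} :=
  [set [ffun x => t.1.1 * f x + trace p e F (t.1.2 * x) + t.2]
     | t : ('F_p * F * 'F_p)%type].

(* Main.v *)
(* For c = a f + Tr(b x) + c0 with a != 0, orthogonality of additive characters writes
   p times the number of zeros of c as q plus a sum over s in F_p^* of Galois conjugates
   (zeta |-> zeta^s) of a Walsh value of f. Since sqrt_pstar = +-G(eta0), such a conjugation
   multiplies sqrt_pstar by eta0(s), and the sum collapses to a trivial (e even) or a
   quadratic (e odd) exponential sum; only G^2 = eta0(-1) p is needed, not the sign of G.

   Self-orthogonality: C_f contains the constants, so for e >= 3 all fibres of all codewords
   have size divisible by p, hence every codeword is isotropic.

   Dual distance: weights 1 and 2 are excluded by nondegeneracy of the trace. A zero x != 0
   of f gives the dual word on {0, x, 2x}, and a coincidence f x = f y gives one on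
   {x, -x, y, -y}. Zeros are missing only when e = 2 and eps eta0(-1) = -1; then every
   nonzero codeword has at most p + 1 zeros, and counting incidences in the pencil of
   codewords vanishing at two points shows that no third point is forced: {(x, f x)} together
   with the vertical point at infinity is an ovoid. *)

Require Import Defs.
From HB Require Import structures.
From mathcomp Require Import all_boot all_order all_algebra all_field.
From mathcomp Require Import cyclic zify ring.
Import Order.TTheory GRing.Theory Num.Theory.
Local Open Scope ring_scope.

(** * Additive characters and Gauss sums over F_p *)

Definition chi (p : nat) (a : 'F_p) : algC := zeta p ^+ (nat_of_ord a).

Section PrimeField.

Variable p : nat.
Hypotheses (p_pr : prime p) (p_odd : odd p).

Lemma zeta_expp : zeta p ^+ p = 1.
Proof. by rewrite /zeta exprAC rootCK ?prime_gt0 // sqrrN expr1n. Qed.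

Lemma zeta_neq1 : zeta p != 1.
Proof.
have p_gt0 := prime_gt0 p_pr; have p_gt1 := prime_gt1 p_pr.
rewrite /zeta sqrf_eq1 negb_or rootC_eq1 // lt_eqF ?(lt_trans _ ltr01) ?ltrN10 //=.
(* For odd p the number -1 is itself a p-th root of -1; it is excluded because [nthroot] never picks
   a negative real for p > 1. *)
by apply/eqP => h; have := rootC_lt0 (-1 : algC) p_gt1; rewrite h oppr_lt0 ltr01.
Qed.

Lemma zeta_prim : p.-primitive_root (zeta p).
Proof.
have [m m_prim m_dvd] := prim_order_exists (prime_gt0 p_pr) zeta_expp.
case/primeP: p_pr => _ /(_ _ m_dvd) /orP[/eqP m1|/eqP m_p]; last by rewrite m_p in m_prim.
by case/negP: zeta_neq1; have := prim_expr_order m_prim; rewrite m1 expr1 => ->.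
Qed.

Lemma chi_nat (n : nat) : chi p n%:R = zeta p ^+ n.
Proof. by rewrite /chi val_Fp_nat // (expr_mod _ zeta_expp). Qed.

Lemma Fp_natE (a : 'F_p) : (nat_of_ord a)%:R = a.
Proof. by rewrite natr_Zp. Qed.

Lemma chi0 : chi p 0 = 1.
Proof. by rewrite /chi expr0. Qed.

Lemma chiD a b : chi p (a + b) = chi p a * chi p b.
Proof. by rewrite -[a]Fp_natE -[b]Fp_natE -natrD !chi_nat exprD. Qed.

Lemma chi_eq1 a : (chi p a == 1) = (a == 0).
Proof.
rewrite /chi -[1](expr0 (zeta p)) (eq_prim_root_expr zeta_prim) mod0n.
rewrite modn_small; last by have := ltn_ord a; rewrite {2}Fp_cast.
by [].
Qed.

(** Reindexing by [tr] multiplies the sum by [chi p k], which differs from 1. The index type and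
    predicate are arbitrary so that the same argument serves sums over the prime field, over F, over
    all words and over a linear code. *)
Lemma chi_sum_shift (T : finType) (A : pred T) (phi : T -> 'F_p) (tr : T -> T) k :
    injective tr -> (forall x, A (tr x) = A x) ->
    (forall x, phi (tr x) = k + phi x) -> k != 0 ->
  \sum_(x | A x) chi p (phi x) = 0.
Proof.
move=> tr_inj A_tr phi_tr nz; set S := \sum_(x | _) _.
have : S = chi p k * S.
  rewrite {1}/S (reindex_inj tr_inj) /= mulr_sumr.
  by apply: eq_big => [x|x _]; rewrite ?A_tr // phi_tr chiD.
move/eqP; rewrite -subr_eq0 -{1}[S]mul1r -mulrBl mulf_eq0 subr_eq0 eq_sym.
by rewrite chi_eq1 (negbTE nz) => /eqP.
Qed.

Lemma chi_sum_scale t : \sum_(y : 'F_p) chi p (y * t) = p%:R * (t == 0)%:R.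
Proof.
have [->|nz] := eqVneq t 0.
  under eq_bigr do rewrite mulr0 chi0.
  by rewrite sumr_const card_Fp // mulr1.
rewrite mulr0; apply: (@chi_sum_shift _ _ (fun y => y * t) (+%R 1) t) => //.
  exact: addrI.
by move=> x; rewrite mulrDl mul1r.
Qed.

Lemma chi_sum_scale_neq0 t :
  \sum_(y : 'F_p | y != 0) chi p (y * t) = p%:R * (t == 0)%:R - 1.
Proof.
have := chi_sum_scale t; rewrite (bigD1 0) //= mul0r chi0 => <-.
by rewrite addrC addrK.
Qed.

Lemma Fp_prim_root : exists w : 'F_p, (p.-1).-primitive_root w.
Proof.
have p1 : (0 < p.-1)%N by have := odd_prime_gt2 p_odd p_pr; lia.
have h : all (p.-1).-unity_root (enum (predC1 (0%R : 'F_p))).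
  apply/allP => x; rewrite mem_enum inE /= => nz; apply/unity_rootP.
  apply: (mulfI nz); rewrite -exprS prednK ?prime_gt0 // mulr1.
  by have := expf_card x; rewrite card_Fp.
have sz : (p.-1 <= size (enum (predC1 (0%R : 'F_p))))%N.
  by rewrite -cardE cardC1 card_Fp.
by have /hasP[w _ w_prim] := has_prim_root p1 h (enum_uniq _) sz; exists w.
Qed.

Lemma Fp_expE (w : 'F_p) : (p.-1).-primitive_root w ->
  forall x, x != 0 -> exists i : nat, x = w ^+ i.
Proof.
move=> w_prim x nz; have [|i ->] := prim_rootP w_prim (x := x); last by exists i.
apply: (mulfI nz); rewrite -exprS prednK ?prime_gt0 // mulr1.
by have := expf_card x; rewrite card_Fp.
Qed.

Lemma prim_root_neq0 {w : 'F_p} : (p.-1).-primitive_root w -> w != 0.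
Proof.
move=> w_prim; apply/eqP => w0; have := prim_expr_order w_prim.
by rewrite w0 expr0n; case: (p.-1) (prim_order_gt0 w_prim).
Qed.

(** Squares are exactly the even powers of a primitive root. Multiplicativity of [eta0] then becomes
    additivity of exponents. *)
Lemma eta0_prim (w : 'F_p) : (p.-1).-primitive_root w ->
  forall i : nat, eta0 p (w ^+ i) = (-1) ^+ i.
Proof.
move=> w_prim i; have nz := prim_root_neq0 w_prim.
rewrite /eta0 expf_eq0 (negbTE nz) andbF -signr_odd.
case: existsP => [[z /eqP zi]|nsq]; case odd_i : (odd i) => //=.
- have z_nz : z != 0.
    by apply/eqP => z0; move/eqP: zi; rewrite z0 expr0n /= eq_sym expf_eq0 (negbTE nz) andbF.
  have [j zj] := Fp_expE w w_prim z z_nz.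
  move: zi; rewrite zj -exprM => /eqP; rewrite (eq_prim_root_expr w_prim) => /eqP h.
  (* Exponents are only known modulo p - 1, but p - 1 is even, so their parity is well defined. *)
  have := congr1 odd h; rewrite !odd_mod ?oddM ?andbF ?odd_i //.
    by have := prime_gt0 p_pr; lia.
  by have := prime_gt0 p_pr; lia.
- case: nsq; exists (w ^+ i./2); rewrite -exprM muln2.
  by rewrite -{2}(odd_double_half i) odd_i.
Qed.

Lemma eta0_0 : eta0 p 0 = 0.
Proof. by rewrite /eta0 eqxx. Qed.

Lemma eta0M x y : eta0 p (x * y) = eta0 p x * eta0 p y.
Proof.
have [->|nx] := eqVneq x 0; first by rewrite mul0r eta0_0 mul0r.
have [->|ny] := eqVneq y 0; first by rewrite mulr0 eta0_0 mulr0.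
have [w w_prim] := Fp_prim_root.
have [i ->] := Fp_expE w w_prim x nx; have [j ->] := Fp_expE w w_prim y ny.
by rewrite -exprD !eta0_prim // exprD.
Qed.

Lemma eta0_sqr x : x != 0 -> eta0 p x ^+ 2 = 1.
Proof.
by rewrite /eta0 => /negbTE ->; case: ifP => _; rewrite ?sqrrN expr1n.
Qed.

Lemma eta0_pm x : x != 0 -> eta0 p x = 1 \/ eta0 p x = -1.
Proof. by rewrite /eta0 => /negbTE ->; case: ifP => _; [left|right]. Qed.

(** Multiplication by a primitive root permutes the field and negates [eta0]. *)
Lemma eta0_sum : \sum_(t : 'F_p) eta0 p t = 0.
Proof.
have [w w_prim] := Fp_prim_root; set S := \sum_t _.
have : S = - S.
  rewrite {1}/S (reindex_inj (mulfI (prim_root_neq0 w_prim))) /=.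
  under eq_bigr do rewrite eta0M -{1}[w]expr1 eta0_prim // expr1 mulN1r.
  by rewrite sumrN.
move/eqP; rewrite -subr_eq0 opprK -mulr2n mulrn_eq0 /=.
by move/eqP.
Qed.

Lemma eta0N1 : eta0 p (-1) = (-1) ^+ (p.-1)./2.
Proof.
have [w w_prim] := Fp_prim_root.
rewrite -(eta0_prim w w_prim); congr (eta0 p _); apply/esym/eqP.
have : (w ^+ (p.-1)./2) ^+ 2 == 1.
  rewrite -exprM muln2 even_halfK ?(prim_expr_order w_prim) //.
  by have := prime_gt0 p_pr; lia.
rewrite sqrf_eq1 => /orP[h|//].
move: h; rewrite -(prim_order_dvd w_prim) => /dvdn_leq.
by have := odd_prime_gt2 p_odd p_pr; lia.
Qed.

Lemma gauss_eta0E : gauss_eta0 p = \sum_y eta0 p y * chi p y.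
Proof.
rewrite /gauss_eta0 [RHS](bigD1 0) //= eta0_0 mul0r add0r.
by apply: eq_bigr.
Qed.

(** For s nonzero, substitute y s for y and use that [eta0 p s] is its own inverse. At s = 0 both
    sides vanish, because [eta0] sums to 0. *)
Lemma gauss_twist s : \sum_y eta0 p y * chi p (y * s) = eta0 p s * gauss_eta0 p.
Proof.
have [->|nz] := eqVneq s 0.
  under eq_bigr do rewrite mulr0 chi0 mulr1.
  by rewrite eta0_sum eta0_0 mul0r.
rewrite gauss_eta0E [X in _ * X](reindex_inj (mulIf nz)) /= mulr_sumr.
apply: eq_bigr => y _; rewrite eta0M.
by rewrite mulrA mulrCA -expr2 eta0_sqr // mulr1.
Qed.

Lemma gauss_sqr : gauss_eta0 p ^+ 2 = eta0 p (-1) * p%:R.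
Proof.
rewrite expr2 {1}gauss_eta0E mulr_suml.
under eq_bigr => y _.
  (* The second factor G is expanded as a sum twisted by y, which merges both characters into chi (y
     (z + 1)); the sum over y then keeps only z = -1. *)
  rewrite mulrAC -gauss_twist mulr_suml.
  under eq_bigr => z _ do rewrite -mulrA -chiD -[X in _ + X]mulr1 [z * y]mulrC -mulrDr.
  over.
rewrite exchange_big /=.
under eq_bigr => z _ do rewrite -mulr_sumr chi_sum_scale addr_eq0.
rewrite (bigD1 (-1)) //= eqxx mulr1 big1 ?addr0 // => z /negbTE ->.
by rewrite !mulr0.
Qed.

Lemma sqrt_pstar_sqr : sqrt_pstar p ^+ 2 = eta0 p (-1) * p%:R.
Proof.
rewrite /sqrt_pstar eta0N1 -signr_odd.
case: eqP => h; rewrite ?exprMn ?sqrCi sqrtCK.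
  by rewrite (_ : odd _ = false) ?mul1r //; lia.
by rewrite (_ : odd _ = true) ?expr1 //; lia.
Qed.

(** Both numbers have the same square. Whatever the sign, it is rational, hence fixed by every field
    automorphism. *)
Lemma sqrt_pstar_gauss :
  exists2 d : algC, d = 1 \/ d = -1 & sqrt_pstar p = d * gauss_eta0 p.
Proof.
have /eqP := etrans sqrt_pstar_sqr (esym gauss_sqr).
rewrite eqf_sqr => /orP[] /eqP ->; [exists 1 | exists (-1)]; auto.
  by rewrite mul1r.
by rewrite mulN1r.
Qed.

(** The automorphism raises p-th roots of unity to the power s, so it turns the Gauss sum into its
    twist by s. *)
Lemma chi_galois (s : 'F_p) : s != 0 ->
  exists u : {rmorphism algC -> algC},
    (forall a, u (chi p a) = chi p (s * a)) /\
    u (sqrt_pstar p) = eta0 p s * sqrt_pstar p.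
Proof.
move=> nz; have cop : coprime s p.
  rewrite coprime_sym prime_coprime //; apply/negP => /dvdn_leq.
  have := ltn_ord s; rewrite {2}Fp_cast // => lt_sp.
  by rewrite lt0n => /(_ nz); rewrite leqNgt lt_sp.
have [u uE] := Qn_aut_exists cop.
have u_chi a : u (chi p a) = chi p (s * a).
  rewrite uE; last by rewrite /chi exprAC zeta_expp expr1n.
  by rewrite -exprM mulnC -chi_nat natrM !Fp_natE.
exists u; split=> //.
have u_eta y : u (eta0 p y) = eta0 p y.
  by rewrite /eta0; do 2?case: ifP => _; rewrite ?rmorph0 ?rmorphN1 ?rmorph1.
have u_gauss : u (gauss_eta0 p) = eta0 p s * gauss_eta0 p.
  rewrite -gauss_twist gauss_eta0E rmorph_sum; apply: eq_bigr => y _.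
  by rewrite rmorphM /= u_eta u_chi mulrC [s * y]mulrC mulrC.
have [d d_pm ->] := sqrt_pstar_gauss.
rewrite rmorphM /= u_gauss mulrCA; congr (_ * (_ * _)).
by case: d_pm => ->; rewrite ?rmorphN1 ?rmorph1.
Qed.

End PrimeField.

(** * The absolute trace *)

Section Trace.

Variables (p e : nat) (F : finFieldType).
Hypotheses (p_pr : prime p) (e_gt0 : (0 < e)%N) (cardF : #|F| = (p ^ e)%N).

Let charF : p \in [pchar F]. Proof. exact: card_finPcharP cardF p_pr. Qed.

(** The inclusion of the prime subfield, spelled as the cast in [trace] and [in_RF] so that both
    convert to it. *)
Definition Fp_embed (a : 'F_p) : F := (nat_of_ord a)%:R.

Lemma Fp_embed_nat n : Fp_embed n%:R = n%:R.
Proof. by rewrite /Fp_embed val_Fp_nat // GRing.natr_mod_pchar. Qed.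

Lemma Fp_embedD a b : Fp_embed (a + b) = Fp_embed a + Fp_embed b.
Proof. by rewrite -[a]Fp_natE -[b]Fp_natE -natrD !Fp_embed_nat natrD. Qed.

Lemma Fp_embedM a b : Fp_embed (a * b) = Fp_embed a * Fp_embed b.
Proof. by rewrite -[a]Fp_natE -[b]Fp_natE -natrM !Fp_embed_nat natrM. Qed.

Lemma Fp_embed_eq0 a : (Fp_embed a == 0) = (a == 0).
Proof.
rewrite /Fp_embed -(dvdn_pcharf charF); apply/idP/eqP => [h|->]; last exact: dvdn0.
apply/val_inj => /=; apply/eqP; move: h; apply: contraLR; rewrite -lt0n => a_gt0.
by rewrite gtnNdvd // -[X in (_ < X)%N](Fp_cast p_pr) ltn_ord.
Qed.

Lemma Fp_embed_inj : injective Fp_embed.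
Proof.
move=> a b h; apply/eqP; rewrite -subr_eq0 -Fp_embed_eq0.
have := Fp_embedD (a - b) b; rewrite subrK h => /eqP.
by rewrite -subr_eq0 opprD addrCA subrr addr0 oppr_eq0.
Qed.

Lemma Fp_embed_exp a n : Fp_embed a ^+ n = Fp_embed (a ^+ n).
Proof.
elim: n => [|n IHn]; first by rewrite !expr0 (Fp_embed_nat 1).
by rewrite !exprS IHn Fp_embedM.
Qed.

Lemma Fp_embed_expp a i : Fp_embed a ^+ (p ^ i) = Fp_embed a.
Proof.
elim: i => [|i IHi]; first by rewrite expr1.
rewrite expnSr exprM IHi Fp_embed_exp; congr Fp_embed.
by have := expf_card a; rewrite card_Fp.
Qed.

(** The p embedded elements already exhaust the roots of X^p - X. *)
Lemma Fp_embed_fixed y : y ^+ p = y -> exists a, Fp_embed a = y.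
Proof.
move=> yp; have [|no] := boolP (y \in codom Fp_embed).
  by case/codomP => a ->; exists a.
pose P : {poly F} := 'X^p - 'X.
have szP : size P = p.+1.
  by rewrite size_polyDl ?size_polyN ?size_polyXn ?size_polyX ?ltnS ?prime_gt1.
have P_nz : P != 0 by rewrite -size_poly_eq0 szP.
have := @max_poly_roots _ P (y :: codom Fp_embed) P_nz.
rewrite szP /= no size_codom card_Fp // ltnn => H; exfalso; suff: false by []; apply: H.
  rewrite /root !hornerE ?hornerXn yp subrr eqxx /=.
  apply/allP => _ /codomP[a ->]; rewrite /root !hornerE.
  by rewrite -{1}[p]expn1 Fp_embed_expp subrr.
by apply/injectiveP; apply: Fp_embed_inj.
Qed.

(** Frobenius shifts the terms cyclically, since x^(p^e) = x. *)
Lemma abs_trace_fixed (x : F) :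
  (\sum_(i < e) x ^+ (p ^ i)) ^+ p = \sum_(i < e) x ^+ (p ^ i).
Proof.
rewrite -(pFrobenius_autE charF) rmorph_sum /=.
under eq_bigr => i _ do rewrite pFrobenius_autE -exprM -expnSr.
case: e e_gt0 cardF => // n _ cardF'.
rewrite big_ord_recr big_ord_recl /= addrC -cardF' expf_card expr1; congr (_ + _).
Qed.

(** The power sum is fixed by Frobenius, hence lies in the prime subfield, so the default value 0 in
    [trace] is never reached by a failed search. *)
Lemma traceE x : Fp_embed (trace p e F x) = \sum_(i < e) x ^+ (p ^ i).
Proof.
rewrite /trace; case: pickP => [a /eqP //|none].
have [a aE] := Fp_embed_fixed _ (abs_trace_fixed x).
by have := none a; rewrite -aE eqxx.
Qed.

Lemma traceD x y : trace p e F (x + y) = trace p e F x + trace p e F y.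
Proof.
apply: Fp_embed_inj; rewrite Fp_embedD !traceE -big_split /=.
apply: eq_bigr => i _; apply: exprDn_pchar.
by rewrite pnatX (pnatE _ p_pr) charF.
Qed.

Lemma traceZ a x : trace p e F (Fp_embed a * x) = a * trace p e F x.
Proof.
apply: Fp_embed_inj; rewrite Fp_embedM !traceE mulr_sumr.
by apply: eq_bigr => i _; rewrite exprMn Fp_embed_expp.
Qed.

Lemma trace0 : trace p e F 0 = 0.
Proof.
have /eqP := traceD 0 0; rewrite addr0 -subr_eq0 opprD addrCA subrr addr0 oppr_eq0.
by move/eqP.
Qed.

(** The trace is a polynomial of degree at most p^(e-1), too small to vanish on all p^e elements. *)
Lemma trace_neq0 : exists x, trace p e F x != 0.
Proof.
apply/existsP; rewrite -[X in is_true X]negbK negb_exists; apply/negP => /forallP all0.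
pose P : {poly F} := \sum_(i < e) 'X^(p ^ i).
have szP : (size P <= (p ^ e.-1).+1)%N.
  apply: (leq_trans (size_sum _ _ _)); apply/bigmax_leqP => i _.
  by rewrite size_polyXn ltnS leq_exp2l ?prime_gt1 // -ltnS prednK.
have P_nz : P != 0.
  (* The coefficient of X is 1: it comes from i = 0 alone. *)
  apply/eqP => /(congr1 (fun q : {poly F} => q`_1)); rewrite coef0 coef_sum.
  case: e e_gt0 => // n _; rewrite big_ord_recl coefXn /= big1 => [|i _].
    by rewrite addr0 => /eqP; rewrite oner_eq0.
  rewrite coefXn -(expn0 p) eqn_exp2l ?prime_gt1 //.
have roots_P : all (root P) (enum F).
  apply/allP => x _; rewrite /root horner_sum.
  under eq_bigr do rewrite hornerXn.
  by rewrite -traceE; have := all0 x; rewrite negbK => /eqP ->; rewrite Fp_embed_eq0.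
have := max_poly_roots P_nz roots_P (enum_uniq _).
rewrite -cardE cardF ltnNge => /negP; apply; apply: (leq_trans szP).
by rewrite ltn_exp2l ?prime_gt1 // prednK.
Qed.

Lemma trace_nondeg y : y != 0 -> exists b, trace p e F (b * y) != 0.
Proof.
by have [x xP] := trace_neq0 => nz; exists (x / y); rewrite divfK.
Qed.

End Trace.

(** * Exponential sums over the nonzero scalars, twisted by a power of the quadratic character *)

Definition eta_exp_sum (p e : nat) (u : 'F_p) : algC :=
  \sum_(s : 'F_p | s != 0) eta0 p s ^+ e * chi p (s * u).

Section EtaExpSum.

Variables (p e : nat).
Hypotheses (p_pr : prime p) (p_odd : odd p).

Lemma eta_exp_sum_even u : ~~ odd e -> eta_exp_sum p e u = p%:R * (u == 0)%:R - 1.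
Proof.
move=> e_even; rewrite -(chi_sum_scale_neq0 p p_pr); apply: eq_bigr => s nz.
by rewrite -[e]even_halfK // -muln2 mulnC exprM eta0_sqr // expr1n mul1r.
Qed.

(** An odd power of [eta0] is [eta0] itself, so this is a twisted Gauss sum. It takes the three
    values 0, G and -G, against the two values p - 1 and -1 for even e. *)
Lemma eta_exp_sum_odd u : odd e -> eta_exp_sum p e u = eta0 p u * gauss_eta0 p.
Proof.
move=> e_odd; rewrite -gauss_twist // [RHS](bigD1 0) //= eta0_0 mul0r add0r.
apply: eq_bigr => s nz.
rewrite -(prednK (odd_gt0 e_odd)) exprSr.
have : ~~ odd e.-1 by case: e e_odd.
by move/even_halfK <-; rewrite -muln2 mulnC exprM eta0_sqr // expr1n mul1r.
Qed.

Lemma gauss_neq0 : gauss_eta0 p != 0.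
Proof.
rewrite -sqrf_eq0 gauss_sqr // mulf_neq0 ?pnatr_eq0 -?lt0n ?prime_gt0 //.
by rewrite eta0N1 // signr_eq0.
Qed.

Lemma sqrt_pstar_neq0 : sqrt_pstar p != 0.
Proof.
have [d dpm ->] := sqrt_pstar_gauss p p_pr p_odd; rewrite mulf_neq0 ?gauss_neq0 //.
by case: dpm => ->; rewrite ?oppr_eq0 oner_eq0.
Qed.

(** Squares and nonsquares are equally many because [eta0] sums to 0. The boolean selects the
    sign. *)
Lemma eta0_card (s : bool) :
  (2 * #|[set u : 'F_p | eta0 p u == (-1) ^+ s]|)%N = p.-1.
Proof.
pose A (s : bool) := [set u : 'F_p | eta0 p u == (-1) ^+ s].
have N1 : (1 == -1 :> algC) = false by rewrite gt_eqF // (lt_trans _ ltr01) ?ltrN10.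
have nzA (t : bool) u : eta0 p u == (-1) ^+ t -> u != 0.
  by case: t; apply: contraTneq => ->; rewrite eta0_0 eq_sym ?oppr_eq0 oner_eq0.
have AC : A true = [set u | u != 0] :\: A false.
  apply/setP => u; rewrite !inE /=; apply/idP/idP => [h|/andP[h nz]].
    by rewrite (nzA true) // (eqP h) eq_sym N1.
  by case: (eta0_pm p u nz) h => ->; rewrite ?eqxx.
have sub : A false \subset [set u | u != 0].
  by apply/subsetP => u; rewrite !inE; apply: (nzA false).
have card_nz : #|[set u : 'F_p | u != 0]| = p.-1.
  rewrite -[in RHS](card_Fp p_pr) -(cardsC1 (0%R : 'F_p)).
  by apply: eq_card => u; rewrite !inE.
have cAA : (#|A true| + #|A false|)%N = p.-1.
  have le := subset_leq_card sub.
  by rewrite AC cardsD (setIidPr sub) card_nz subnK // -card_nz.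
have eqA : #|A true| = #|A false|.
  have := eta0_sum p p_pr p_odd.
  rewrite (bigID (mem (A false))) /= (eq_bigr (fun=> 1)); last first.
    by move=> u; rewrite inE => /eqP.
  rewrite sumr_const (bigID (mem (A true))) /=.
  rewrite [X in _ + (X + _)](eq_bigr (fun=> -1)); last first.
    by move=> u /andP[_]; rewrite inE => /eqP.
  rewrite [X in _ + (_ + X)]big1 => [|u]; last first.
    rewrite !inE => /andP[h1 h2]; have [->|nz] := eqVneq u 0; first by rewrite eta0_0.
    by case: (eta0_pm p u nz) h1 h2 => ->; rewrite ?eqxx.
  rewrite addr0 (eq_bigl (mem (A true))); last first.
    by move=> u; rewrite !inE; case: eqP => //= ->; rewrite N1.
  rewrite sumr_const => /eqP; rewrite mulNrn subr_eq0 eqr_nat => /eqP //.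
by rewrite -/(A s); case: s; lia.
Qed.

End EtaExpSum.

(** * Weights of C_f *)

Section Weights.

Variables (p e : nat) (F : finFieldType) (f : F -> 'F_p).
Hypotheses (p_pr : prime p) (p_odd : odd p) (e_ge2 : (2 <= e)%N).
Hypothesis cardF : #|F| = (p ^ e)%N.

Let e_gt0 : (0 < e)%N. Proof. exact: ltnW e_ge2. Qed.
Let p_gt0 : (0 < p)%N. Proof. exact: prime_gt0 p_pr. Qed.
Let P_neq0 : p%:R != 0 :> algC. Proof. by rewrite pnatr_eq0 -lt0n. Qed.

Notation Tr := (trace p e F).
Notation emb := (Fp_embed p F).
Notation param := ('F_p * F * 'F_p)%type.
Notation C := (code_Cf p e F f).
Local Notation P := (p%:R : algC).

Definition codeword (t : param) : word p F :=
  [ffun x => t.1.1 * f x + Tr (t.1.2 * x) + t.2].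

Definition zeros (c : word p F) : nat := #|[set x | c x == 0]|.

Lemma code_CfE : C = codeword @: [set: param].
Proof.
apply/setP => c; apply/imsetP/imsetP => -[t _ ->]; by exists t; rewrite ?inE.
Qed.

Lemma codeword_in t : codeword t \in C.
Proof. by rewrite code_CfE imset_f // inE. Qed.

Lemma codewordP c : reflect (exists t, c = codeword t) (c \in C).
Proof.
rewrite code_CfE; apply: (iffP imsetP) => [[t _ ->]|[t ->]]; first by exists t.
by exists t; rewrite ?inE.
Qed.

Lemma traceN x : Tr (- x) = - Tr x.
Proof. by apply/eqP; rewrite -addr_eq0 -traceD // addNr trace0. Qed.

Lemma codewordD t t' x : codeword (t + t') x = codeword t x + codeword t' x.
Proof. by rewrite !ffunE /= mulrDl [in Tr _]mulrDl traceD //; ring. Qed.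

Lemma codewordB t t' x : codeword (t - t') x = codeword t x - codeword t' x.
Proof. by rewrite !ffunE /= mulrBl [in Tr _]mulrBl traceD // traceN; ring. Qed.

Lemma codewordZ k t x :
  codeword (k * t.1.1, emb k * t.1.2, k * t.2) x = k * codeword t x.
Proof. by rewrite !ffunE /= -[_ * _ * x]mulrA traceZ //; ring. Qed.

Lemma wt_zeros (c : word p F) : (wt p F c + zeros c)%N = (p ^ e)%N.
Proof.
rewrite -cardF -(cardsC [set x | c x != 0]); congr (_ + _)%N.
by apply: eq_card => x; rewrite !inE negbK.
Qed.

Lemma zeros_chi (c : word p F) :
  P * (zeros c)%:R = \sum_(y : 'F_p) \sum_(x : F) chi p (y * c x).
Proof.
rewrite exchange_big /=; under eq_bigr do rewrite chi_sum_scale //.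
rewrite -mulr_sumr /zeros -sum1_card natr_sum; congr (_ * _).
by rewrite [LHS]big_mkcond /=; apply: eq_bigr => x _; rewrite inE; case: eqP.
Qed.

(** In the orthogonality count of zeros the term y = 0 contributes q, which gives the main term; the
    other y measure the deviation from p^e - p^(e-1). *)
Lemma wt_chi (c : word p F) :
  (wt p F c)%:R = P ^+ e - P ^+ (e - 1)
     - P^-1 * \sum_(y : 'F_p | y != 0) \sum_(x : F) chi p (y * c x).
Proof.
have := zeros_chi c; rewrite (bigD1 0) //= (eq_bigr (fun=> 1)); last first.
  by move=> x _; rewrite mul0r chi0.
rewrite sumr_const cardF natrX; set S := \sum_(y | _) _ => h.
have z : (zeros c)%:R = P^-1 * (P ^+ e + S) by rewrite -h mulKf.
have : (wt p F c)%:R + (zeros c)%:R = P ^+ e by rewrite -natrD wt_zeros natrX.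
move/(canRL (addrK _)) ->; rewrite z mulrDr opprD addrA; congr (_ - _ - _).
by rewrite -[in LHS](subnK e_gt0) addn1 exprS mulKf.
Qed.

(** Translation by a point x0 with Tr(b x0) nonzero kills every character sum in the deviation. *)
Lemma wt_linear b c : b != 0 ->
  (wt p F (codeword (0, b, c)))%:R = P ^+ e - P ^+ (e - 1).
Proof.
move=> nz; rewrite wt_chi big1 ?mulr0 ?subr0 // => y y_nz.
have [x0 x0P] := trace_nondeg p e F p_pr e_gt0 cardF b nz.
under eq_bigr => x _ do rewrite ffunE /= mul0r add0r mulrDr chiD //.
rewrite -mulr_suml (chi_sum_shift p p_pr _ _ _ (+%R x0) (y * Tr (b * x0))) ?mul0r //.
- exact: addrI.
- by move=> x; rewrite mulrDr traceD // mulrDr.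
by rewrite mulf_neq0 // mulrC.
Qed.

Lemma wt_const c : wt p F (codeword (0, 0, c)) = if c == 0 then 0%N else (p ^ e)%N.
Proof.
have -> : codeword (0, 0, c) = [ffun => c].
  by apply/ffunP => x; rewrite !ffunE /= !mul0r trace0 // !add0r.
rewrite /wt; case: eqP => [->|nz].
  by apply/eqP; rewrite cards_eq0; apply/eqP/setP => x; rewrite !inE ffunE eqxx.
rewrite -cardF -cardsT; apply: eq_card => x; rewrite !inE ffunE.
exact/eqP.
Qed.

Section Bent.

Variables (eps : algC) (fstar : F -> 'F_p).
Hypothesis eps_pm : eps = 1 \/ eps = -1.
Hypothesis walshE : forall beta,
  walsh p e F f beta = eps * sqrt_pstar p ^+ e * zeta p ^+ (nat_of_ord (fstar beta)).

(** The constant factor of a Walsh value, divided by the p of the orthogonality relation. *)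
Definition bent_scale : algC := eps * sqrt_pstar p ^+ e / P.

(* The conjugate of the Walsh value under [zeta |-> zeta ^ s] is the exponential sum
   of [s * f], because the automorphism multiplies [sqrt_pstar] by [eta0 s]. *)
Lemma walsh_conj s beta : s != 0 ->
  \sum_x chi p (s * (f x - Tr (beta * x))) =
  eps * sqrt_pstar p ^+ e * (eta0 p s ^+ e * chi p (s * fstar beta)).
Proof.
move=> nz; have [u [u_chi u_sqrt]] := chi_galois p p_pr p_odd s nz.
have walsh_chi : \sum_x chi p (f x - Tr (beta * x)) =
  eps * sqrt_pstar p ^+ e * chi p (fstar beta) by exact: walshE.
have := congr1 u walsh_chi; rewrite rmorph_sum /=.
under eq_bigr do rewrite u_chi.
move=> ->; rewrite !rmorphM /= rmorphXn /= u_sqrt u_chi exprMn.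
have -> : u eps = eps by case: eps_pm => ->; rewrite ?rmorphN1 ?rmorph1.
ring.
Qed.

(** Dividing the codeword by a leaves f(x) - Tr(beta x) + c/a with beta = -b/a; this is the
    resulting phase, with the dual of f evaluated at beta. *)
Definition dual_arg (t : param) : 'F_p :=
  t.2 / t.1.1 + fstar (- (emb (t.1.1)^-1 * t.1.2)).

Lemma wt_bent t : t.1.1 != 0 ->
  (wt p F (codeword t))%:R =
  P ^+ e - P ^+ (e - 1) - bent_scale * eta_exp_sum p e (dual_arg t).
Proof.
case: t => [[a b] c] /= nz; rewrite wt_chi; congr (_ - _).
rewrite /bent_scale [_ / P]mulrC -mulrA; congr (_ * _).
(* Substituting y = s / a makes s the coefficient of f, as [walsh_conj] expects. *)
rewrite (reindex_inj (mulIf (invr_neq0 nz))) /= /eta_exp_sum mulr_sumr.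
apply: eq_big => [s|s s_nz].
  by rewrite mulf_eq0 invr_eq0 (negbTE nz) orbF.
have {}s_nz : s != 0 by move: s_nz; rewrite mulf_eq0 invr_eq0 (negbTE nz) orbF.
under eq_bigr => x _.
  rewrite ffunE /= (_ : s / a * _ =
    s * (f x - Tr (- (emb a^-1 * b) * x)) + s * (c / a)); last first.
    by rewrite mulNr traceN -[_ * b * x]mulrA traceZ //; field.
  rewrite chiD //.
  over.
rewrite -mulr_suml walsh_conj // /dual_arg /= mulrDr chiD //.
ring.
Qed.

(** For fixed a and b, the phase is an affine bijection in c. Hence every phase is equally frequent,
    whatever the dual function is. *)
Lemma card_param_dual_arg (A : {set 'F_p}) :
  #|[set t : param | (t.1.1 != 0) && (dual_arg t \in A)]|
    = ((p - 1) * p ^ e * #|A|)%N.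
Proof.
pose g (t : param) : param := (t.1.1, t.1.2, dual_arg t).
pose B := setX (setX [set a : 'F_p | a != 0] [set: F]) A.
have -> : ((p - 1) * p ^ e * #|A|)%N = #|B|.
  rewrite !cardsX cardsT cardF; congr (_ * _ * _)%N.
  rewrite -[in LHS](card_Fp p_pr) subn1 -(cardsC1 (0%R : 'F_p)).
  by apply: eq_card => u; rewrite !inE.
pose h (t : param) : param :=
  (t.1.1, t.1.2, (t.2 - fstar (- (emb (t.1.1)^-1 * t.1.2))) * t.1.1).
have -> : [set t : param | (t.1.1 != 0) && (dual_arg t \in A)] = h @: B.
  apply/setP => t; rewrite inE; apply/andP/imsetP => [[nz tA]|[[[a b] u]]].
    exists (g t); first by rewrite !inE nz.
    case: t nz {tA} => [[a b] c] /= nz.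
    by rewrite /h /g /dual_arg /= addrK divfK.
  rewrite !inE /= => /andP[/andP[nz _] uA] -> /=.
  by rewrite nz /dual_arg /= mulfK // subrK.
apply/card_in_imset => -[[a b] u] [[a' b'] u'].
rewrite !inE /= => /andP[/andP[nz _] _] _ /eqP; rewrite /h /= !xpair_eqE /= -andbA.
case/and3P => /eqP <- /eqP <- /eqP /(mulIf nz) /eqP; rewrite subr_eq subrK.
by move/eqP ->.
Qed.

End Bent.
End Weights.

(** * Dimension of C_f and frequencies of its weights *)

Lemma pm1_mul (R : pzRingType) (x y : R) :
  x = 1 \/ x = -1 -> y = 1 \/ y = -1 -> x * y = 1 \/ x * y = -1.
Proof.
by case=> -> []->; rewrite ?mulr1 ?mul1r ?mulrNN ?mulr1; auto.
Qed.

Section Freq.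

Variables (p e : nat) (F : finFieldType) (f : F -> 'F_p).
Hypotheses (p_pr : prime p) (p_odd : odd p) (e_ge2 : (2 <= e)%N).
Hypothesis cardF : #|F| = (p ^ e)%N.
Variables (eps : algC) (fstar : F -> 'F_p).
Hypothesis eps_pm : eps = 1 \/ eps = -1.
Hypothesis walshE : forall beta,
  walsh p e F f beta = eps * sqrt_pstar p ^+ e * zeta p ^+ (nat_of_ord (fstar beta)).

Let e_gt0 : (0 < e)%N. Proof. exact: ltnW e_ge2. Qed.
Let p_gt0 : (0 < p)%N. Proof. exact: prime_gt0 p_pr. Qed.
Let p_gt1 : (1 < p)%N. Proof. exact: prime_gt1 p_pr. Qed.
Let P_neq0 : p%:R != 0 :> algC. Proof. by rewrite pnatr_eq0 -lt0n. Qed.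

Notation Tr := (trace p e F).
Notation emb := (Fp_embed p F).
Notation param := ('F_p * F * 'F_p)%type.
Notation C := (code_Cf p e F f).
Notation cw := (codeword p e F f).
Notation scale := (bent_scale p e eps).
Notation darg := (dual_arg p F fstar).
Local Notation P := (p%:R : algC).

Lemma bent_scale_neq0 : scale != 0.
Proof.
rewrite /bent_scale !mulf_neq0 ?invr_eq0 ?expf_neq0 ?sqrt_pstar_neq0 //.
by case: eps_pm => ->; rewrite ?oppr_eq0 oner_eq0.
Qed.

Lemma bent_scale_even m : e = (m.*2.+2)%N ->
  scale = eps * eta0 p (-1) ^+ m.+1 * P ^+ m.
Proof.
move=> eE; rewrite /bent_scale eE -doubleS -muln2 mulnC exprM sqrt_pstar_sqr //.
by rewrite exprMn [P ^+ m.+1]exprSr; field.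
Qed.

(** The one unpaired factor [sqrt_pstar] is a sign times the Gauss sum, and together with the extra
    Gauss sum it gives G^2, which is p up to sign. *)
Lemma bent_scale_odd m : e = (m.*2.+1)%N ->
  exists2 d : algC, d = 1 \/ d = -1 & scale * gauss_eta0 p = d * P ^+ m.
Proof.
move=> eE; have [d d_pm dE] := sqrt_pstar_gauss p p_pr p_odd.
exists (eps * d * eta0 p (-1) ^+ m.+1).
  apply: pm1_mul; first exact: pm1_mul.
  rewrite eta0N1 // -exprM -signr_odd.
  by case: (odd _); [right|left]; rewrite ?expr0 ?expr1.
have -> : scale * gauss_eta0 p =
    eps * d * (sqrt_pstar p ^+ 2) ^+ m * gauss_eta0 p ^+ 2 / P.
  by rewrite /bent_scale eE exprS -muln2 mulnC exprM dE; ring.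
by rewrite sqrt_pstar_sqr // gauss_sqr // exprMn exprS; field.
Qed.

(** A form common to both parities: the bound on k with m + 2 <= e locates the weights strictly
    between 0 and p^e, and m >= 1 for e >= 3 makes them divisible by p. *)
Lemma bent_value_int : exists m : nat,
  [/\ (m.+2 <= e)%N, (3 <= e -> 1 <= m)%N &
   forall u, exists2 k : int, (`|k| <= p - 1)%N &
     scale * eta_exp_sum p e u = (k * (p ^ m)%:Z)%:~R].
Proof.
have sgn d n : d = 1 \/ d = -1 ->
    exists2 k : int, (`|k| = 1)%N & d * (-1) ^+ n = k%:~R :> algC.
  move=> d_pm; exists (if (d == 1) (+) odd n then 1%Z else -1).
    by case: ifP.
  have N1 : (-1 == 1 :> algC) = false by rewrite lt_eqF // (lt_trans _ ltr01) ?ltrN10.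
  rewrite -signr_odd; case: d_pm => ->; rewrite ?eqxx ?N1; case: (odd n) => /=;
    by rewrite ?expr0 ?expr1 ?mulr1 ?mulrN1 ?opprK ?rmorphN ?rmorph1.
case: (boolP (odd e)) => [e_odd|e_even].
(* Here e = 2m + 1. *)
- exists e./2; split; try lia; move=> u.
  have [|d d_pm dE] := bent_scale_odd e./2; first by lia.
  have [->|nz] := eqVneq u 0.
    by exists 0 => //; rewrite eta_exp_sum_odd // eta0_0 mul0r mulr0 mul0r.
  have [k k1 kE] : exists2 k : int, (`|k| = 1)%N & d * eta0 p u = k%:~R.
    case: (eta0_pm p u nz) => ->; [have := sgn d 0%N d_pm|have := sgn d 1%N d_pm];
    by rewrite ?expr0 ?expr1.
  exists k; first by rewrite k1; have := p_gt1; lia.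
  rewrite eta_exp_sum_odd // mulrCA dE mulrA [eta0 p u * d]mulrC kE rmorphM /=.
  by rewrite -pmulrn natrX.
(* Here e = 2m + 2, and m = 0 exactly when e = 2. *)
- exists (e./2).-1; split; try lia; move=> u.
  have [k k1 kE] := sgn eps ((p.-1)./2 * (e./2).-1.+1)%N eps_pm.
  exists (k * (p%:Z * (u == 0)%:Z - 1)).
    by rewrite abszM k1; case: eqP => _; rewrite ?mulr1 ?mulr0; have := p_gt1; lia.
  rewrite (bent_scale_even (e./2).-1); last by lia.
  rewrite eta0N1 // -exprM kE eta_exp_sum_even //.
  rewrite !rmorphM /= rmorphB /= rmorphM /= -!pmulrn natrX.
  by ring.
Qed.

(** With a = 1 and b = 0, the constant c can be chosen to produce any phase. Each formal value is
    thus an actual weight and inherits the range bounds. *)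
Lemma bent_value_wt u : exists2 t : param, t.1.1 != 0 &
  (wt p F (cw t))%:R = P ^+ e - P ^+ (e - 1) - scale * eta_exp_sum p e u.
Proof.
exists (1, 0, u - fstar (- (emb 1^-1 * 0))); first exact: oner_neq0.
rewrite (wt_bent p e F f p_pr p_odd e_ge2 cardF eps fstar) ?oner_neq0 //.
by rewrite /dual_arg /= divr1 subrK.
Qed.

Lemma wt_bent_int t : t.1.1 != 0 -> exists m (k : int),
  [/\ (m.+2 <= e)%N, (3 <= e -> 1 <= m)%N, (`|k| <= p - 1)%N &
      (wt p F (cw t))%:Z = (p ^ e)%:Z - (p ^ (e - 1))%:Z - k * (p ^ m)%:Z].
Proof.
move=> nz; have [m [m1 m2 /(_ (darg t)) [k k1 kE]]] := bent_value_int.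
exists m, k; split=> //; apply/eqP; rewrite -(eqr_int algC).
rewrite -pmulrn (wt_bent p e F f p_pr p_odd e_ge2 cardF eps fstar) // kE.
by rewrite !rmorphB /= -!pmulrn !natrX.
Qed.

(** The deviation is at most (p - 1) p^m, strictly less than p^(e-1). *)
Lemma wt_bent_range t : t.1.1 != 0 ->
  ((0 < wt p F (cw t)) && (wt p F (cw t) < p ^ e))%N.
Proof.
move=> nz; have [m [k [m1 _ k1 wtE]]] := wt_bent_int t nz.
have eq1 : (p ^ e = p * p ^ (e - 1))%N by rewrite -expnS subn1 prednK.
have B_gt0 : (0 < p ^ m)%N by rewrite expn_gt0 p_gt0.
have le_pB : (p * p ^ m <= p ^ (e - 1))%N.
  by rewrite -expnS leq_exp2l //; lia.
by have := p_gt1; move: wtE; rewrite eq1; move: (wt _ _ _) B_gt0 le_pB k1 {eq1} => w; nia.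
Qed.

Lemma base_nat : P ^+ e - P ^+ (e - 1) = (p ^ e - p ^ (e - 1))%:R.
Proof.
by rewrite natrB ?natrX // leq_exp2l // leq_subr.
Qed.

Lemma base_range : ((0 < p ^ e - p ^ (e - 1)) && (p ^ e - p ^ (e - 1) < p ^ e))%N.
Proof.
have eq1 : (p ^ e = p * p ^ (e - 1))%N by rewrite -expnS subn1 prednK.
have A_gt0 : (0 < p ^ (e - 1))%N by rewrite expn_gt0 p_gt0.
by have := p_gt1; rewrite eq1; nia.
Qed.

(** Each class of nonzero parameters has positive weight; this makes the parametrisation injective
    and yields dimension e + 2. *)
Lemma codeword_eq0 t : wt p F (cw t) = 0%N -> t = 0.
Proof.
case: t => [[a b] c]; have [->|nz] := eqVneq a 0; last first.
  by move=> w0; have := wt_bent_range (a, b, c) nz; rewrite w0.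
have [->|nz] := eqVneq b 0.
  rewrite wt_const //; case: eqP => [-> //|_] /eqP.
  by rewrite expn_eq0 e_gt0 andbT eqn0Ngt p_gt0.
move=> w0; have := wt_linear p e F f p_pr e_ge2 cardF b c nz.
rewrite w0 base_nat => /eqP; rewrite eqr_nat => /eqP h.
by have := base_range; rewrite -h.
Qed.

Lemma codeword_inj : injective cw.
Proof.
move=> t t' eq_tt'; apply/eqP; rewrite -subr_eq0; apply/eqP/codeword_eq0/eqP.
rewrite cards_eq0; apply/eqP/setP => x.
by rewrite !inE codewordB // eq_tt' subrr eqxx.
Qed.

Lemma code_Cf_linear : is_linear_code p F C.
Proof.
split.
  suff -> : zero_word p F = cw 0 by exact: codeword_in.
  by apply/ffunP => x; rewrite !ffunE /= !mul0r trace0 // !addr0.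
move=> k _ _ /codewordP[t ->] /codewordP[t' ->]; apply/codewordP.
pose kt : param := (k * t.1.1, emb k * t.1.2, k * t.2).
exists (kt + t'); apply/ffunP => x; rewrite ffunE.
rewrite -(codewordZ p e F f p_pr e_ge2 cardF k t x).
exact: esym (codewordD p e F f p_pr e_ge2 cardF kt t' x).
Qed.

Lemma card_code_Cf : #|C| = (p ^ (e + 2))%N.
Proof.
rewrite code_CfE card_imset; last exact: codeword_inj.
by rewrite cardsT !card_prod card_Fp // cardF -expnS -expnSr addn2.
Qed.

Lemma code_Cf_nk : is_nk_code p F C (p ^ e) (e + 2).
Proof. by split; [exact: code_Cf_linear | | exact: card_code_Cf]. Qed.

(** The terms count the zero word, the nonzero constants, the words with a = 0 and b nonzero, and
    those with a nonzero. The boolean factors leave open which of these weights coincide. *)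
Lemma freqE (w : algC) : freq p F C w =
  ((0 == w)%R + (p - 1) * (P ^+ e == w)%R +
   p * (p ^ e - 1) * (P ^+ e - P ^+ (e - 1) == w)%R +
   (p - 1) * p ^ e *
     #|[set u | (P ^+ e - P ^+ (e - 1) - scale * eta_exp_sum p e u == w)%R]|)%N.
Proof.
have -> : freq p F C w = #|[set t : param | (wt p F (cw t))%:R == w]|.
  rewrite /freq -(card_imset _ codeword_inj); apply: eq_card => c.
  rewrite !inE; apply/andP/imsetP => [[/codewordP[t ->] h]|[t]].
    by exists t; rewrite ?inE.
  by rewrite inE => h ->; rewrite codeword_in.
set B := P ^+ e - P ^+ (e - 1).
pose X := [set t : param | (wt p F (cw t))%:R == w].
pose X1 := [set t : param | t.1.1 == 0 & t.1.2 == 0].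
pose X2 := [set t : param | t.1.1 == 0].
rewrite -/X -(cardsID X2 X) -(cardsID X1 (X :&: X2)); congr (_ + _ + _)%N.
- rewrite (_ : X :&: X2 :&: X1 =
     (fun c : 'F_p => (0 : 'F_p, 0 : F, c)) @: [set c | (if c == 0 then 0 else P ^+ e) == w]).
    rewrite card_imset => [|c c' [//]]; rewrite -(cardsID [set 0]); congr (_ + _)%N.
      rewrite (_ : _ :&: _ = if 0 == w then [set 0] else set0).
        by case: eqP => _; rewrite ?cards1 ?cards0.
      apply/setP => c; rewrite !inE; have [->|nz] := eqVneq c 0.
        by case: (0 == w); rewrite !inE ?eqxx.
      by case: (0 == w); rewrite !inE ?andbF ?(negbTE nz).
    rewrite (_ : _ :\: _ = if P ^+ e == w then [set~ 0] else set0).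
      by case: eqP => _; rewrite ?cards0 ?muln0 ?muln1 // cardsC1 card_Fp // subn1.
    apply/setP => c; rewrite !inE; have [->|nz] := eqVneq c 0.
      by case: (P ^+ e == w); rewrite !inE ?eqxx.
    by case: (P ^+ e == w); rewrite !inE ?nz.
  apply/setP => -[[a b] c]; rewrite !inE /=; apply/idP/imsetP.
    case/andP => /andP[h _] /andP[/eqP a0 /eqP b0]; exists c; last by rewrite a0 b0.
    move: h; rewrite inE a0 b0 wt_const //.
    by case: (c == 0); rewrite ?natrX.
  case=> c'; rewrite inE => h [-> -> ->]; rewrite !eqxx /= !andbT wt_const //.
  by move: h; case: (c' == 0); rewrite ?natrX.
- rewrite (_ : _ :\: _ = if B == w then setX (setX [set 0] [set~ 0]) setT else set0).
    case: eqP => _; rewrite ?cards0 ?muln0 // muln1 !cardsX cards1 cardsC1 cardsT.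
    by rewrite cardF card_Fp // mul1n subn1 mulnC.
  apply/setP => -[[a b] c]; rewrite !inE /=.
  have [->|a_nz] /= := eqVneq a 0; last by case: ifP; rewrite !inE /= ?(negbTE a_nz) ?andbF.
  have [->|b_nz] /= := eqVneq b 0; first by case: ifP; rewrite !inE /= ?eqxx.
  rewrite (wt_linear p e F f p_pr e_ge2 cardF b c b_nz) -/B andbT.
  by case: ifP; rewrite !inE /= ?eqxx ?b_nz.
rewrite -(card_param_dual_arg p e F p_pr cardF fstar); apply: eq_card => t; rewrite !inE.
have [//|nz] := eqVneq t.1.1 0.
by rewrite (wt_bent p e F f p_pr p_odd e_ge2 cardF eps fstar).
Qed.

Lemma bent_value_neq u :
  (0 == P ^+ e - P ^+ (e - 1) - scale * eta_exp_sum p e u = false) *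
  (P ^+ e == P ^+ e - P ^+ (e - 1) - scale * eta_exp_sum p e u = false).
Proof.
have [t nz <-] := bent_value_wt u; have := wt_bent_range t nz.
by rewrite -natrX (eqr_nat _ 0%N) eqr_nat; split; lia.
Qed.

Lemma base_neq :
  (0 == P ^+ e - P ^+ (e - 1) = false) * (P ^+ e == P ^+ e - P ^+ (e - 1) = false).
Proof.
have := base_range; rewrite base_nat -natrX (eqr_nat _ 0%N) eqr_nat.
by split; lia.
Qed.

Lemma Pe_neq0 : (0 == P ^+ e) = false.
Proof. by rewrite eq_sym expf_eq0 (negbTE P_neq0) andbF. Qed.

Lemma bent_value_eq u v :
  (P ^+ e - P ^+ (e - 1) - scale * eta_exp_sum p e u ==
   P ^+ e - P ^+ (e - 1) - scale * eta_exp_sum p e v)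
  = (eta_exp_sum p e u == eta_exp_sum p e v).
Proof. by rewrite (inj_eq (addrI _)) eqr_opp (inj_eq (mulfI bent_scale_neq0)). Qed.

Lemma bent_value_base u :
  (P ^+ e - P ^+ (e - 1) - scale * eta_exp_sum p e u == P ^+ e - P ^+ (e - 1))
  = (eta_exp_sum p e u == 0).
Proof.
by rewrite -subr_eq0 addrAC subrr add0r oppr_eq0 mulf_eq0 (negbTE bent_scale_neq0).
Qed.

Lemma freq_zero : freq p F C 0 = 1%N.
Proof.
rewrite freqE eqxx ![_ == 0]eq_sym Pe_neq0 base_neq !muln0 !addn0.
rewrite (_ : [set u | _] = set0) ?cards0 ?muln0 //.
by apply/setP => u; rewrite !inE eq_sym bent_value_neq.
Qed.

Lemma freq_full : freq p F C (P ^+ e) = (p - 1)%N.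
Proof.
rewrite freqE Pe_neq0 eqxx muln1 [_ - _ == _]eq_sym base_neq muln0 add0n addn0.
rewrite (_ : [set u | _] = set0) ?cards0 ?muln0 ?addn0 //.
by apply/setP => u; rewrite !inE eq_sym bent_value_neq.
Qed.

(** The second term is present because for odd e the exponential sum vanishes at u = 0, so some
    words with a nonzero share the weight of the affine ones. *)
Lemma freq_base :
  freq p F C (P ^+ e - P ^+ (e - 1)) =
  (p * (p ^ e - 1) + (p - 1) * p ^ e * #|[set u | (eta_exp_sum p e u == 0)%R]|)%N.
Proof.
rewrite freqE !base_neq eqxx muln1 muln0 !add0n; congr (_ + _ * _)%N.
by apply: eq_card => u; rewrite !inE bent_value_base.
Qed.

Lemma freq_bent v : eta_exp_sum p e v != 0 ->
  freq p F C (P ^+ e - P ^+ (e - 1) - scale * eta_exp_sum p e v) =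
  ((p - 1) * p ^ e * #|[set u | eta_exp_sum p e u == eta_exp_sum p e v]|)%N.
Proof.
move=> nz; rewrite freqE !bent_value_neq eq_sym bent_value_base (negbTE nz) !muln0 !add0n.
by congr (_ * _)%N; apply: eq_card => u; rewrite !inE bent_value_eq.
Qed.

Lemma code_Cf_weights c : c \in C ->
  [\/ (wt p F c)%:R = 0 :> algC, (wt p F c)%:R = P ^+ e,
      (wt p F c)%:R = P ^+ e - P ^+ (e - 1) |
      exists u, (wt p F c)%:R = P ^+ e - P ^+ (e - 1) - scale * eta_exp_sum p e u].
Proof.
case/codewordP => -[[a b] d] ->; have [->|nz] := eqVneq a 0; last first.
  constructor 4; exists (darg (a, b, d)).
  by rewrite (wt_bent p e F f p_pr p_odd e_ge2 cardF eps fstar).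
have [->|nz] := eqVneq b 0; last by constructor 3; rewrite wt_linear.
by rewrite wt_const //; case: eqP => _; [constructor 1|constructor 2; rewrite natrX].
Qed.

End Freq.

(** * The weight distributions for even and odd e *)

Section Distribution.

Variables (p e : nat) (F : finFieldType) (f : F -> 'F_p).
Hypotheses (p_pr : prime p) (p_odd : odd p) (e_ge2 : (2 <= e)%N).
Hypothesis cardF : #|F| = (p ^ e)%N.
Variables (eps : algC) (fstar : F -> 'F_p).
Hypothesis eps_pm : eps = 1 \/ eps = -1.
Hypothesis walshE : forall beta,
  walsh p e F f beta = eps * sqrt_pstar p ^+ e * zeta p ^+ (nat_of_ord (fstar beta)).

Let p_gt0 : (0 < p)%N. Proof. exact: prime_gt0 p_pr. Qed.
Let p_gt1 : (1 < p)%N. Proof. exact: prime_gt1 p_pr. Qed.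
Let P_neq0 : p%:R != 0 :> algC. Proof. by rewrite pnatr_eq0 -lt0n. Qed.

Notation C := (code_Cf p e F f).
Notation scale := (bent_scale p e eps).
Local Notation P := (p%:R : algC).
Local Notation base := (P ^+ e - P ^+ (e - 1)).

Let freqB := freq_bent p e F f p_pr p_odd e_ge2 cardF eps fstar eps_pm walshE.
Let freq_b := freq_base p e F f p_pr p_odd e_ge2 cardF eps fstar eps_pm walshE.
Let weights := code_Cf_weights p e F f p_pr p_odd e_ge2 cardF eps fstar eps_pm walshE.

Lemma weight_distribution_even : ~~ odd e ->
  [/\ freq p F C 0 = 1%N,
      freq p F C (base - eps * (P - 1) * sqrt_pstar p ^+ e / P)
        = ((p - 1) * p ^ e)%N,
      freq p F C (base + eps * sqrt_pstar p ^+ e / P)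
        = ((p - 1) ^ 2 * p ^ e)%N,
      freq p F C base = (p * (p ^ e - 1))%N &
      freq p F C (P ^+ e) = (p - 1)%N /\
      forall c, c \in C -> (wt p F c)%:R \in
        [:: 0; base - eps * (P - 1) * sqrt_pstar p ^+ e / P;
            base + eps * sqrt_pstar p ^+ e / P; base; P ^+ e]].
Proof.
move=> e_even.
have k0 : eta_exp_sum p e 0 = P - 1 by rewrite eta_exp_sum_even // eqxx mulr1.
have k1 u : u != 0 -> eta_exp_sum p e u = -1.
  by move=> nz; rewrite eta_exp_sum_even // (negbTE nz) mulr0 add0r.
have P1 : P - 1 != 0 by rewrite -(natrB _ (ltnW p_gt1)) pnatr_eq0 -lt0n subn_gt0.
have PN : (P - 1 == -1) = false.
  by rewrite -subr_eq0 opprK subrK (negbTE P_neq0).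
have N1 : (-1 == 0 :> algC) = false by rewrite oppr_eq0 oner_eq0.
(* The two bent weights are rewritten as the values at phase 0 and at phase 1, the latter standing
   for all nonzero phases. *)
have e0 : eps * (P - 1) * sqrt_pstar p ^+ e / P = scale * eta_exp_sum p e 0.
  by rewrite k0 /bent_scale; field.
have e1 : base + eps * sqrt_pstar p ^+ e / P = base - scale * eta_exp_sum p e 1.
  by rewrite k1 ?oner_neq0 // mulrN1 opprK.
rewrite e0 e1; split.
- exact: (freq_zero p e F f p_pr p_odd e_ge2 cardF eps fstar).
- rewrite freqB ?k0 // (_ : [set u | _] = [set 0]) ?cards1 ?muln1 //.
  apply/setP => u; rewrite !inE; have [->|nz] := eqVneq u 0; first by rewrite k0 eqxx.
  by rewrite k1 // eq_sym PN.
- rewrite freqB ?k1 ?oner_neq0 ?N1 // (_ : [set u | _] = [set~ 0]).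
    by rewrite cardsC1 card_Fp //; nia.
  apply/setP => u; rewrite !inE; have [->|nz] := eqVneq u 0; first by rewrite k0 PN.
  by rewrite k1 // eqxx.
- rewrite freq_b (_ : [set u | _] = set0) ?cards0 ?muln0 ?addn0 //.
  apply/setP => u; rewrite !inE; have [->|nz] := eqVneq u 0; first by rewrite k0 (negbTE P1).
  by rewrite k1 // N1.
split=> [|c cC]; first exact: (freq_full p e F f p_pr p_odd e_ge2 cardF eps fstar).
rewrite !inE; case: (weights c cC) => [->|->|->|[u ->]]; rewrite ?eqxx ?orbT //.
have [->|nz] := eqVneq u 0; first by rewrite eqxx ?orbT.
by rewrite (k1 u) // (k1 1) ?oner_neq0 // eqxx ?orbT.
Qed.

Lemma weight_distribution_odd : odd e ->
  [/\ freq p F C 0 = 1%N,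
      freq p F C (base - eps * sqrt_pstar p ^+ e * gauss_eta0 p / P)
        = (((p - 1) ^ 2 * p ^ e) %/ 2)%N,
      freq p F C (base + eps * sqrt_pstar p ^+ e * gauss_eta0 p / P)
        = (((p - 1) ^ 2 * p ^ e) %/ 2)%N,
      freq p F C base = (2 * p ^ e.+1 - p ^ e - p)%N &
      freq p F C (P ^+ e) = (p - 1)%N /\
      forall c, c \in C -> (wt p F c)%:R \in
        [:: 0; base - eps * sqrt_pstar p ^+ e * gauss_eta0 p / P;
            base + eps * sqrt_pstar p ^+ e * gauss_eta0 p / P; base; P ^+ e]].
Proof.
move=> e_odd.
have G0 := gauss_neq0 p p_pr p_odd.
have kE u : eta_exp_sum p e u = eta0 p u * gauss_eta0 p by exact: eta_exp_sum_odd.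
have eta_ex (s : bool) : exists v, eta0 p v = (-1) ^+ s.
  have c_gt0 : (0 < #|[set u : 'F_p | eta0 p u == ((-1) ^+ s)%R]|)%N.
    by have := eta0_card p p_pr p_odd s; have := odd_prime_gt2 p_odd p_pr; lia.
  by case/card_gt0P: c_gt0 => v; rewrite inE => /eqP; exists v.
have half (s : bool) v : eta0 p v = (-1) ^+ s ->
    freq p F C (base - scale * eta_exp_sum p e v) = (((p - 1) ^ 2 * p ^ e) %/ 2)%N.
  move=> vE; rewrite freqB; last by rewrite kE vE mulf_neq0 ?signr_eq0.
  have <- : [set u : 'F_p | eta0 p u == (-1) ^+ s] =
      [set u | eta_exp_sum p e u == eta_exp_sum p e v].
    by apply/setP => u; rewrite !inE !kE vE (inj_eq (mulIf G0)).
  have := eta0_card p p_pr p_odd s; set n := #|_| => nE.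
  rewrite (_ : (p - 1) ^ 2 * p ^ e = (p - 1) * p ^ e * n * 2)%N ?mulnK //.
  by rewrite -subn1 in nE; rewrite -nE; ring.
(* A nonzero square and a nonsquare represent the two classes of nonzero phases, each of size (p -
   1)/2. *)
have [v0 v0E] := eta_ex false; have [v1 v1E] := eta_ex true.
have e0 : eps * sqrt_pstar p ^+ e * gauss_eta0 p / P = scale * eta_exp_sum p e v0.
  by rewrite kE v0E /bent_scale; field.
have e1 : base + scale * eta_exp_sum p e v0 = base - scale * eta_exp_sum p e v1.
  by rewrite !kE v0E v1E expr0 expr1 mulN1r mulrN opprK mul1r.
rewrite e0 e1; split.
- exact: (freq_zero p e F f p_pr p_odd e_ge2 cardF eps fstar).
- exact: half v0E.
- exact: half v1E.
- rewrite freq_b (_ : [set u | _] = [set 0]) ?cards1 ?muln1.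
    have q_gt0 : (0 < p ^ e)%N by rewrite expn_gt0 p_gt0.
    by rewrite expnS; nia.
  apply/setP => u; rewrite !inE kE mulf_eq0 (negbTE G0) orbF.
  have [->|nz] := eqVneq u 0; first by rewrite eta0_0 eqxx.
  by case: (eta0_pm p u nz) => ->; rewrite ?oppr_eq0 oner_eq0.
split=> [|c cC]; first exact: (freq_full p e F f p_pr p_odd e_ge2 cardF eps fstar).
rewrite !inE; case: (weights c cC) => [->|->|->|[u ->]]; rewrite ?eqxx ?orbT //.
have [->|nz] := eqVneq u 0.
  by rewrite [eta_exp_sum p e 0]kE eta0_0 mul0r mulr0 subr0 eqxx ?orbT.
case: (eta0_pm p u nz) => uE.
  by rewrite (_ : eta_exp_sum p e u = eta_exp_sum p e v0) ?eqxx ?orbT // !kE uE v0E.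
by rewrite (_ : eta_exp_sum p e u = eta_exp_sum p e v1) ?eqxx ?orbT // !kE uE v1E.
Qed.

End Distribution.

(** * Linear codes and their duals *)

Section LinearCodes.

Variables (p : nat) (F : finFieldType).
Hypothesis p_pr : prime p.
Implicit Types (u v c : word p F) (D : {set word p F}).

Lemma dot_sym u v : dot p F u v = dot p F v u.
Proof. by apply: eq_bigr => x _; rewrite mulrC. Qed.

Lemma dotDr u v v' : dot p F u (v + v') = dot p F u v + dot p F u v'.
Proof. by rewrite /dot -big_split; apply: eq_bigr => x _; rewrite ffunE mulrDr. Qed.

Lemma dotDl u u' v : dot p F (u + u') v = dot p F u v + dot p F u' v.
Proof. by rewrite dot_sym dotDr !(dot_sym v). Qed.

Lemma zero_wordE : zero_word p F = 0.
Proof. by []. Qed.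

Lemma wt_eq0 c : (wt p F c == 0%N) = (c == 0).
Proof.
rewrite cards_eq0; apply/eqP/eqP => [h|->]; last first.
  by apply/setP => x; rewrite !inE ffunE eqxx.
by apply/ffunP => x; move/setP/(_ x): h; rewrite !inE ffunE => /negbFE/eqP.
Qed.

Lemma linear_codeD D u v : is_linear_code p F D -> u \in D -> v \in D -> u + v \in D.
Proof.
case=> _ lin uD vD; have := lin 1 u v uD vD.
by congr (_ \in D); apply/ffunP => x; rewrite !ffunE mul1r.
Qed.

Lemma linear_codeB D u v : is_linear_code p F D -> u \in D -> v \in D -> u - v \in D.
Proof.
case=> _ lin uD vD; have := lin (-1) v u vD uD.
by congr (_ \in D); apply/ffunP => x; rewrite !ffunE mulN1r addrC.
Qed.

Lemma linear_code_translate D u : is_linear_code p F D -> u \in D ->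
  forall v, (u + v \in D) = (v \in D).
Proof.
move=> lin uD v; apply/idP/idP => h; last exact: linear_codeD.
by rewrite -[v](addKr u) addrC; apply: linear_codeB.
Qed.

Lemma dual_codeP D v :
  reflect (forall u, u \in D -> dot p F u v = 0) (v \in dual_code p F D).
Proof.
rewrite inE; apply: (iffP forallP) => [h u uD|h u]; last first.
  by apply/implyP => /h ->.
by apply/eqP; have := h u; rewrite uD.
Qed.

Lemma dual_code_linear D : is_linear_code p F (dual_code p F D).
Proof.
split=> [|k u v /dual_codeP uD /dual_codeP vD]; apply/dual_codeP => c cD.
  by rewrite /dot big1 // => x _; rewrite ffunE mulr0.
have -> : dot p F c [ffun x => k * u x + v x] = k * dot p F c u + dot p F c v.
  rewrite /dot mulr_sumr -big_split; apply: eq_bigr => x _ /=.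
  by rewrite ffunE mulrDr mulrCA.
by rewrite uD // vD // mulr0 addr0.
Qed.

(** Outside the dual, v defines a nontrivial character of D, whose sum vanishes. *)
Lemma chi_sum_code D v : is_linear_code p F D ->
  \sum_(u in D) chi p (dot p F u v) = (#|D| * (v \in dual_code p F D))%:R.
Proof.
move=> lin; case: dual_codeP => [orth|/dual_codeP].
  rewrite muln1 (eq_bigr (fun=> 1)) ?sumr_const // => u uD.
  by rewrite orth // chi0.
rewrite inE negb_forall => /existsP[u0]; rewrite negb_imply => /andP[u0D nz].
rewrite muln0; apply: (chi_sum_shift p p_pr _ _ _ (+%R u0) (dot p F u0 v)) => //.
- exact: addrI.
- exact: linear_code_translate.
by move=> u; rewrite dotDl.
Qed.

(** Double counting of chi(u.v) over u in D and all words v: summing over u first detects the dual,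
    summing over v first detects u = 0. *)
Lemma card_dual_code D : is_linear_code p F D ->
  (#|D| * #|dual_code p F D|)%N = (p ^ #|F|)%N.
Proof.
move=> lin; apply/eqP; rewrite -(eqr_nat algC); apply/eqP.
transitivity (\sum_(v : word p F) \sum_(u in D) chi p (dot p F u v)).
  under eq_bigr do rewrite chi_sum_code // natrM.
  rewrite -mulr_sumr natrM; congr (_ * _); rewrite -sum1_card natr_sum.
  by rewrite big_mkcond; apply: eq_bigr => v _; case: (_ \in _).
have [D0 _] := lin.
rewrite exchange_big /= (bigD1 (zero_word p F)) //= (eq_bigr (fun=> 1)) => [|v _]; last first.
  by rewrite /dot big1 ?chi0 // => x _; rewrite ffunE mul0r.
rewrite sumr_const card_ffun card_Fp // big1 ?addr0 // => u /andP[_ u_nz].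
have [x nz] : exists x, u x != 0.
  apply/existsP; apply: contraR u_nz; rewrite negb_exists => /forallP h.
  by apply/eqP/ffunP => x; rewrite ffunE; apply/eqP; have := h x; rewrite negbK.
(* Shifting v by this unit vector adds the nonzero entry [u x] to the dot product. *)
pose d : word p F := [ffun y => (y == x)%:R].
apply: (chi_sum_shift p p_pr _ _ _ (+%R d) (dot p F u d)) => //.
- exact: addrI.
- by move=> v; rewrite dotDr.
rewrite /dot (bigD1 x) //= ffunE eqxx mulr1 big1 ?addr0 // => y /negbTE ny.
by rewrite ffunE ny mulr0.
Qed.

(* With the constants in the code, every fibre of a codeword is the zero set of
   another codeword, so its size is divisible by p. *)
Lemma divisible_code_self_orthogonal D : odd p -> is_linear_code p F D ->
  (forall k : 'F_p, [ffun => k] \in D) -> (p %| #|F|)%N ->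
  (forall c, c \in D -> (p %| wt p F c)%N) -> D \subset dual_code p F D.
Proof.
move=> p_odd lin cst p_dvdF p_dvd.
have sqr0 c : c \in D -> dot p F c c = 0.
  move=> cD; rewrite /dot (partition_big c predT) //= big1 // => k _.
  rewrite (eq_bigr (fun=> k ^+ 2)) => [|x /eqP ->]; last by rewrite expr2.
  rewrite sumr_const -mulr_natr.
  have p_dvd_fib : (p %| #|[pred x | c x == k]|)%N.
    have wE : (wt p F (c - [ffun => k])%R + #|[pred x | c x == k]|)%N = #|F|.
      rewrite -(cardC [pred x | c x == k]) addnC; congr (_ + _)%N.
      by apply: eq_card => x; rewrite !inE !ffunE subr_eq0.
    rewrite -(dvdn_addr _ (p_dvd _ (linear_codeB D c _ lin cD (cst k)))).
    by rewrite wE.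
  case/dvdnP: p_dvd_fib => n; rewrite -/(#|_|) => ->.
  by rewrite natrM pchar_Fp_0 // !mulr0.
apply/subsetP => v vD; apply/dual_codeP => u uD.
(* Polarisation: isotropy of u, v and u + v gives 2 u.v = 0, and p is odd. *)
have := sqr0 _ (linear_codeD D u v lin uD vD).
rewrite dotDl !dotDr !sqr0 // add0r addr0 (dot_sym v) -mulr2n -mulr_natl => /eqP.
rewrite mulf_eq0 -(dvdn_pcharf (pchar_Fp p_pr)) => /orP[|/eqP //].
by move/dvdn_leq; have := odd_prime_gt2 p_odd p_pr; lia.
Qed.

(** Subtracting a fixed member sends each nonempty fibre injectively into the kernel, and there are
    p fibres. Thus one linear condition costs at most a factor p. *)
Lemma card_additive_kernel (A : {set word p F}) (phi : word p F -> 'F_p) :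
    (forall x y, x \in A -> y \in A -> x - y \in A) ->
    (forall x y, phi (x - y) = phi x - phi y) ->
  (#|A| <= p * #|[set x in A | phi x == 0%R]|)%N.
Proof.
move=> AB phiB; rewrite -[X in (_ <= X * _)%N](card_Fp p_pr) -sum_nat_const -sum1_card.
rewrite (partition_big phi predT) //=; apply: leq_sum => k _; rewrite sum1_card.
set fib := [pred x in A | phi x == k].
have [x0|none] := pickP fib; last by rewrite (eq_card none) card0.
case/andP=> x0A /eqP x0k; rewrite -(card_image (addIr (- x0))).
apply/subset_leq_card/subsetP => _ /imageP[x /andP[xA /eqP xk] ->].
by rewrite !inE AB // phiB xk x0k subrr eqxx.
Qed.

End LinearCodes.

(** Distance 5 would require 1 + q(p-1) + C(q,2)(p-1)^2 <= p^2 q. For q >= 9 the quadratic term is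
    at least 4q(p-1)^2 >= q p^2 already. This excludes d + 1 when d = 4 and d + 2 when d = 3. *)
Lemma sphere_packing_radius2 (p e : nat) : (2 < p)%N -> (2 <= e)%N ->
  ~~ sphere_packing_ok p (p ^ e) (p ^ e - e - 2) 5.
Proof.
move=> p_gt2 e_ge2; have p_gt0 : (0 < p)%N by lia.
(* This makes the truncated subtraction in the dimension exact. *)
have q_ge : (e + 2 <= p ^ e)%N.
  elim: e e_ge2 => // -[|[|e]] IHe // _; first by nia.
  by have := IHe isT; rewrite [(p ^ e.+3)%N]expnS; nia.
have q9 : (9 <= p ^ e)%N.
  apply: (leq_trans (n := (3 ^ 2)%N)) => //; apply: (leq_trans (n := (p ^ 2)%N)).
    by rewrite leq_exp2r.
  by rewrite leq_exp2l //; lia.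
rewrite /sphere_packing_ok -ltnNge.
have -> : (p ^ (p ^ e) = p ^ (p ^ e - e - 2) * (p ^ e * p ^ 2))%N.
  by rewrite -!expnD; congr (_ ^ _)%N; lia.
rewrite ltn_pmul2l ?expn_gt0 ?p_gt0 //.
rewrite !big_ord_recr big_ord0 /= bin0 bin1 !expn0 expn1.
have := bin_ffact (p ^ e) 2; rewrite ffactnS ffactn1 => b2.
move: b2 q9; set q := (p ^ e)%N; set B := 'C(q, 2) => b2 q9.
have {}b2 : (B * 2 = q * (q - 1))%N by rewrite -subn1 in b2.
have h1 : (p ^ 2 <= 4 * (p - 1) ^ 2)%N by nia.
have h2 : (8 * (p - 1) ^ 2 <= (q - 1) * (p - 1) ^ 2)%N by rewrite leq_mul2r; lia.
have h3 : (q * (2 * p ^ 2) <= q * ((q - 1) * (p - 1) ^ 2))%N by rewrite leq_mul2l; lia.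
by nia.
Qed.

(** * The dual of C_f *)

Section Dual.

Variables (p e : nat) (F : finFieldType) (f : F -> 'F_p).
Hypotheses (p_pr : prime p) (p_odd : odd p) (e_ge2 : (2 <= e)%N).
Hypothesis cardF : #|F| = (p ^ e)%N.

Let e_gt0 : (0 < e)%N. Proof. exact: ltnW e_ge2. Qed.
Let p_gt0 : (0 < p)%N. Proof. exact: prime_gt0 p_pr. Qed.
Let p_gt2 : (2 < p)%N. Proof. exact: odd_prime_gt2 p_odd p_pr. Qed.
Let charF : p \in [pchar F]. Proof. exact: card_finPcharP cardF p_pr. Qed.

Notation Tr := (trace p e F).
Notation emb := (Fp_embed p F).
Notation param := ('F_p * F * 'F_p)%type.
Notation C := (code_Cf p e F f).
Notation cw := (codeword p e F f).
Notation dualC := (dual_code p F C).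

Lemma trace_sum (g : F -> F) : Tr (\sum_x g x) = \sum_x Tr (g x).
Proof. by apply: (big_morph Tr) => [x y|]; rewrite ?traceD ?trace0. Qed.

(** The dot product with a codeword splits into parts linear in a, b and c; nondegeneracy of the
    trace turns the condition for all b into one equation in F. *)
Lemma dual_code_CfP (v : word p F) :
  reflect [/\ \sum_x v x = 0, \sum_x emb (v x) * x = 0 & \sum_x v x * f x = 0]
          (v \in dualC).
Proof.
have dotE a b c : dot p F (cw (a, b, c)) v =
    a * (\sum_x v x * f x) + Tr (b * \sum_x emb (v x) * x) + c * \sum_x v x.
  rewrite !mulr_sumr trace_sum -!big_split /=; apply: eq_bigr => x _.
  by rewrite ffunE /= [b * (_ * x)]mulrCA traceZ //; ring.
apply: (iffP (dual_codeP _ _ _ _)) => [orth|[h1 h2 h3] _ /codewordP[[[a b] c] ->]].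
  split; first 1 last.
  - apply/eqP; apply/negPn/negP => nz.
    have [b /eqP] := trace_nondeg p e F p_pr e_gt0 cardF _ nz; apply.
    by have := orth _ (codeword_in p e F f (0, b, 0)); rewrite dotE !mul0r add0r addr0.
  - have := orth _ (codeword_in p e F f (1, 0, 0)).
    by rewrite dotE !mul0r trace0 // !addr0 mul1r.
  have := orth _ (codeword_in p e F f (0, 0, 1)).
  by rewrite dotE !mul0r trace0 // !add0r mul1r.
by rewrite dotE h1 h2 h3 !mulr0 trace0 // !addr0.
Qed.

Lemma sum_support (v : word p F) (V : zmodType) (g : 'F_p -> F -> V) :
  (forall x, g 0 x = 0) ->
  \sum_x g (v x) x = \sum_(x in [set x | v x != 0]) g (v x) x.
Proof.
move=> g0; rewrite [RHS]big_mkcond; apply: eq_bigr => x _; rewrite inE.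
by case: eqP => // ->.
Qed.

Lemma Fp_embedN a : emb (- a) = - emb a.
Proof. by apply/eqP; rewrite -addr_eq0 -(Fp_embedD p e F p_pr cardF) addNr. Qed.

(** The sum of entries rules out weight 1. At weight 2 it makes the entries opposite, and the second
    moment then forces the two points to coincide. *)
Lemma dual_code_Cf_wt_ge3 v : v \in dualC -> v != zero_word p F -> (3 <= wt p F v)%N.
Proof.
case/dual_code_CfP => h1 h2 _; rewrite zero_wordE -wt_eq0 => nz.
have S1 := sum_support v _ (fun a _ => a) (fun=> erefl).
have S2 := sum_support v _ (fun a x => emb a * x) (fun x => mul0r x).
rewrite h1 in S1; rewrite h2 in S2.
have [//|w_le2] := leqP 3 (wt p F v).
have w12 : (wt p F v == 1)%N || (wt p F v == 2)%N.
  by case: (wt p F v) nz w_le2 => [|[|[|]]].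
case/orP: w12 => [/cards1P[x0 sE]|/cards2P[x0 [x1 [ne sE]]]].
  have x0S : v x0 != 0.
    by have : x0 \in [set x | v x != 0]; [rewrite sE inE | rewrite inE].
  by move: x0S S1; rewrite sE big_set1 => + v0; rewrite -v0 eqxx.
have x0S : v x0 != 0.
  by have : x0 \in [set x | v x != 0]; [rewrite sE !inE eqxx | rewrite inE].
move: S1 S2; rewrite sE !big_setU1 ?inE //= !big_set1 => S1.
have -> : v x1 = - v x0 by apply/eqP; rewrite -addr_eq0 addrC -S1.
rewrite Fp_embedN => /esym/eqP; rewrite mulNr -mulrBr mulf_eq0.
rewrite (Fp_embed_eq0 p e F p_pr cardF) (negbTE x0S) /=.
by rewrite subr_eq0 (negbTE ne).
Qed.

(** The syndrome of v for the parity-check columns (1, x, f x). *)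
Definition moments (v : word p F) : param :=
  (\sum_x v x, \sum_x emb (v x) * x, \sum_x v x * f x).

Definition delta (a : F) : word p F := [ffun y => (y == a)%:R].

Lemma moments_eq0 v : moments v = 0 -> v \in dualC.
Proof. by case=> h1 h2 h3; apply/dual_code_CfP. Qed.

Lemma momentsB u v : moments (u - v) = moments u - moments v.
Proof.
congr (_, _, _); rewrite -sumrB; apply: eq_bigr => x _; rewrite !ffunE //.
  by rewrite (Fp_embedD p e F p_pr cardF) Fp_embedN mulrBl.
by rewrite mulrBl.
Qed.

Lemma moments_delta a : moments (delta a) = (1, a, f a).
Proof.
have only_a (V : zmodType) (g : 'F_p -> F -> V) :
    (forall x, g 0 x = 0) -> \sum_x g (delta a x) x = g 1 a.
  move=> g0; rewrite (bigD1 a) //= ffunE eqxx big1 ?addr0 // => x /negbTE nx.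
  by rewrite ffunE nx.
rewrite /moments (only_a _ (fun k _ => k)) // (only_a _ (fun k x => emb k * x)); last first.
  by move=> x; rewrite mul0r.
rewrite (only_a _ (fun k x => k * f x)) => [|x]; last by rewrite mul0r.
by rewrite (Fp_embed_nat p e F p_pr cardF 1) !mul1r.
Qed.

Hypothesis f0 : f 0 = 0.
Variable h : nat.
Hypothesis f_homog : forall (a : 'F_p) (x : F), a != 0 ->
  f (emb a * x) = a ^+ h * f x.

Let two_neq0 : 2 != 0 :> F.
Proof. by rewrite -(dvdn_pcharf charF); apply/negP => /dvdn_leq; lia. Qed.

Let two_Fp_neq0 : 2 != 0 :> 'F_p.
Proof. by rewrite -(dvdn_pcharf (pchar_Fp p_pr)); apply/negP => /dvdn_leq; lia. Qed.

Lemma f_double_root x : f x = 0 -> f (2 * x) = 0.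
Proof.
by move=> fx; rewrite -(Fp_embed_nat p e F p_pr cardF 2) f_homog // fx mulr0.
Qed.

(** The second difference along 0, x, 2x, with coefficients 1, -2, 1, kills constants and linear
    forms, and f vanishes at all three points by homogeneity. *)
Lemma dual_word3 x : x != 0 -> f x = 0 -> exists2 v, v \in dualC &
  v != zero_word p F /\ (wt p F v <= 3)%N.
Proof.
move=> x_nz fx; have f2x := f_double_root x fx.
have x2_nz : 2 * x != 0 by rewrite mulf_neq0.
exists (delta 0 - delta x - (delta x - delta (2 * x))); last split.
- apply: moments_eq0; rewrite !momentsB !moments_delta f0 fx f2x.
  by congr (_, _, _) => /=; ring.
- apply/eqP => /ffunP /(_ 0); rewrite !ffunE eqxx eq_sym (negbTE x_nz) eq_sym (negbTE x2_nz).
  by rewrite !subr0 => /eqP; rewrite oner_eq0.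
apply: (@leq_trans #|[set 0; x; 2 * x]|); last first.
  by rewrite !cardsU !cards1; lia.
apply/subset_leq_card/subsetP => y; rewrite !inE !ffunE.
by do 3?case: (y == _); rewrite ?orbT // !subr0 eqxx.
Qed.

Hypothesis h_even : ~~ odd h.

Lemma f_even x : f (- x) = f x.
Proof.
rewrite -mulN1r -[1](Fp_embed_nat p e F p_pr cardF 1) -Fp_embedN f_homog ?oppr_eq0 ?oner_eq0 //.
by rewrite -signr_odd (negbTE h_even) mul1r.
Qed.

(** Since f is even, a coincidence f x = f y gives one value on x, -x, y, -y; coefficients 1, 1, -1,
    -1 then annihilate all three moments. *)
Lemma dual_word4 : exists2 v, v \in dualC &
  v != zero_word p F /\ (wt p F v <= 4)%N.
Proof.
have [x [y [x_nz xy xNy fxy]]] : exists x y, [/\ x != 0, x != y, x != - y & f x = f y].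
  pose Q (x y : F) := [&& x != 0, x != y, x != - y & f x == f y].
  have [/existsP[x /existsP[y /and4P[? ? ? /eqP]]]|] := boolP [exists x, exists y, Q x y].
    by exists x, y.
  rewrite negb_exists => /forallP none; exfalso.
  (* Without a coincidence each fibre of f on nonzero points lies in some {y, -y}, so q - 1 <= 2p,
     contradicting q >= p^2 and p >= 3. *)
  have le2 k : (#|[set x | (x != 0%R) && (f x == k)]| <= 2)%N.
    set A := [set x | _]; have [->|[y]] := set_0Vmem A; first by rewrite cards0.
    rewrite inE => /andP[_ /eqP fy]; apply: (@leq_trans #|[set y; - y]|); last first.
      by rewrite cardsU !cards1; lia.
    apply/subset_leq_card/subsetP => x; rewrite !inE => /andP[x_nz /eqP fx].
    have := none x; rewrite negb_exists => /forallP/(_ y).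
    by rewrite /Q x_nz fx fy eqxx andbT /= negb_and !negbK.
  have : (#|[set~ 0%R : F]| <= 2 * p)%N.
    rewrite -sum1_card (partition_big f predT) //= mulnC -[X in (X * _)%N](card_Fp p_pr).
    rewrite -sum_nat_const; apply: leq_sum => k _; rewrite sum1_card.
    by apply: leq_trans (le2 k); apply/eq_leq/eq_card => x; rewrite unfold_in !inE.
  rewrite cardsC1 cardF.
  have : (p ^ 2 <= p ^ e)%N by rewrite leq_exp2l //; lia.
  by move: p_gt2; nia.
exists (delta x - delta y - (delta (- y) - delta (- x))); last split.
- apply: moments_eq0; rewrite !momentsB !moments_delta !f_even fxy.
  by congr (_, _, _) => /=; ring.
- have xNx : x != - x by rewrite -addr_eq0 -mulr2n -mulr_natl mulf_neq0.
  apply/eqP => /ffunP /(_ x); rewrite !ffunE eqxx (negbTE xy) (negbTE xNy) (negbTE xNx).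
  by rewrite !subr0 => /eqP; rewrite oner_eq0.
apply: (@leq_trans #|[set x; y; - y; - x]|); last first.
  by rewrite !cardsU !cards1; lia.
apply/subset_leq_card/subsetP => z; rewrite !inE !ffunE.
by do 4?case: (z == _); rewrite ?orbT // !subr0 eqxx.
Qed.

End Dual.

(** * Self-orthogonality and dual distance for bent f *)

Section BentDual.

Variables (p e : nat) (F : finFieldType) (f : F -> 'F_p).
Hypotheses (p_pr : prime p) (p_odd : odd p) (e_ge2 : (2 <= e)%N).
Hypothesis cardF : #|F| = (p ^ e)%N.
Variables (eps : algC) (fstar : F -> 'F_p).
Hypothesis eps_pm : eps = 1 \/ eps = -1.
Hypothesis walshE : forall beta,
  walsh p e F f beta = eps * sqrt_pstar p ^+ e * zeta p ^+ (nat_of_ord (fstar beta)).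

Let e_gt0 : (0 < e)%N. Proof. exact: ltnW e_ge2. Qed.
Let p_gt0 : (0 < p)%N. Proof. exact: prime_gt0 p_pr. Qed.
Let p_gt2 : (2 < p)%N. Proof. exact: odd_prime_gt2 p_odd p_pr. Qed.

Notation C := (code_Cf p e F f).
Notation cw := (codeword p e F f).
Notation dualC := (dual_code p F C).

Let C_linear := code_Cf_linear p e F f p_pr e_ge2 cardF.
Let wt_int := wt_bent_int p e F f p_pr p_odd e_ge2 cardF eps fstar eps_pm walshE.
Let wt_range := wt_bent_range p e F f p_pr p_odd e_ge2 cardF eps fstar eps_pm walshE.
Let C_card := card_code_Cf p e F f p_pr p_odd e_ge2 cardF eps fstar eps_pm walshE.

Lemma code_Cf_divisible c : (3 <= e)%N -> c \in C -> (p %| wt p F c)%N.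
Proof.
move=> e_ge3 /codewordP[[[a b] d] ->].
have p_dvdX n : (0 < n)%N -> (p %| p ^ n)%N by move=> n_gt0; rewrite dvdn_exp.
have [->|nz] := eqVneq a 0; last first.
  have [m [k [_ /(_ e_ge3) m_gt0 _ wtE]]] := wt_int (a, b, d) nz.
  have /dvdnP[x xE] := p_dvdX e e_gt0.
  have /dvdnP[y yE] : (p %| p ^ (e - 1))%N by apply: p_dvdX; lia.
  have /dvdnP[z zE] := p_dvdX m m_gt0.
  suff : (p%:Z %| (wt p F (cw (a, b, d)))%:Z)%Z by rewrite dvdzE.
  apply/dvdzP; exists (x%:Z - y%:Z - k * z%:Z).
  by rewrite wtE xE yE zE !PoszM; ring.
have [->|nz] := eqVneq b 0.
  by rewrite wt_const //; case: ifP => // _; apply: p_dvdX.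
have := wt_linear p e F f p_pr e_ge2 cardF b d nz.
rewrite (base_nat p e p_pr) => /eqP; rewrite eqr_nat => /eqP ->.
by rewrite dvdn_sub // p_dvdX //; lia.
Qed.

Lemma code_Cf_self_orthogonal : (3 <= e)%N -> C \subset dualC.
Proof.
move=> e_ge3; apply: divisible_code_self_orthogonal => //.
- move=> k; apply/codewordP; exists (0, 0, k); apply/ffunP => x.
  by rewrite !ffunE /= !mul0r trace0 // !add0r.
- by rewrite cardF dvdn_exp.
by move=> c; apply: code_Cf_divisible.
Qed.

Lemma dual_code_Cf_nk : is_nk_code p F dualC (p ^ e) (p ^ e - e - 2).
Proof.
split=> //; first exact: dual_code_linear.
have := card_dual_code p F p_pr C C_linear; rewrite C_card cardF => cE.
have C_gt0 : (0 < p ^ (e + 2))%N by rewrite expn_gt0 p_gt0.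
apply/eqP; rewrite -(eqn_pmul2l C_gt0) cE -expnD; apply/eqP; congr (_ ^ _)%N.
(* The dual contains the zero word, so |C| <= p^q, which bounds the dimension of C by the length. *)
suff : (e + 2 <= p ^ e)%N by lia.
rewrite -(leq_exp2l (m := p)) ?prime_gt1 // -cE leq_pmulr //.
by apply/card_gt0P; exists (zero_word p F); have [] := dual_code_linear p F C.
Qed.

Section Plane.

Hypothesis e2 : e = 2%N.

Lemma bent_scale_plane : bent_scale p e eps = eps * eta0 p (-1).
Proof.
by rewrite (bent_scale_even p e p_pr p_odd eps 0) ?e2 // expr0 mulr1 expr1.
Qed.

(** For e = 2 the scale is just the sign eps eta0(-1). With sign -1 every nonzero codeword has at
    most p + 1 zeros; with sign 1 the words with a nonzero have 2p - 1 or p - 1 zeros whenever their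
    weight is not p^2 - p. *)
Lemma wt_plane c : c \in C ->
  [\/ wt p F c = 0%N, wt p F c = (p ^ 2)%N, wt p F c = (p ^ 2 - p)%N |
   (eps * eta0 p (-1) = -1 -> wt p F c = (p ^ 2 - 1)%N \/ wt p F c = (p ^ 2 - p - 1)%N)
   /\ (eps * eta0 p (-1) = 1 ->
         wt p F c = (p ^ 2 - p - (p - 1))%N \/ wt p F c = (p ^ 2 - p + 1)%N)].
Proof.
have le1 : (p <= p ^ 2)%N by rewrite -{1}[p]expn1 leq_exp2l // prime_gt1.
have le2 : (p - 1 <= p ^ 2 - p)%N by rewrite -mulnn; nia.
have natI (m n : nat) : m%:R = n%:R :> algC -> m = n.
  by move/eqP; rewrite eqr_nat => /eqP.
have baseE : p%:R ^+ e - p%:R ^+ (e - 1) = (p ^ 2 - p)%:R :> algC.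
  by rewrite e2 expr1 natrB // natrX.
case/(code_Cf_weights p e F f p_pr p_odd e_ge2 cardF eps fstar eps_pm walshE).
- by move/(natI _ 0%N) => ->; constructor 1.
- by rewrite e2 -natrX => /natI ->; constructor 2.
- by rewrite baseE => /natI ->; constructor 3.
case=> u; rewrite baseE bent_scale_plane eta_exp_sum_even ?e2 // => uE.
constructor 4; split=> sE; move: uE; rewrite sE; case: (u == 0).
- rewrite mulr1 mulN1r opprK -(natrB _ (ltnW (ltnW p_gt2))) -natrD => /natI ->; left; lia.
- by rewrite mulr0 add0r mulN1r !opprK => uE; right; apply: natI; rewrite uE [RHS]natrB //; lia.
- rewrite mulr1 mul1r -(natrB _ (ltnW (ltnW p_gt2))) -natrB // => /natI ->; left; lia.
by rewrite mulr0 add0r mul1r opprK natr1 => /natI ->; right; lia.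
Qed.

(* Two distinct points impose two conditions on the code, so at least p^2 codewords
   vanish at both. If all of them also vanished at a third point, counting the pairs
   (codeword, zero) would force more than p + 1 zeros on average. *)
Lemma plane_no_dependent_triple x1 x2 x3 :
    eps * eta0 p (-1) = -1 -> x1 != x2 -> x1 != x3 -> x2 != x3 ->
  exists2 c, c \in C & [/\ c x1 = 0, c x2 = 0 & c x3 != 0].
Proof.
move=> sgn n12 n13 n23.
have [/exists_inP[c cC /and3P[/eqP ? /eqP ? ?]]|] :=
    boolP [exists c in C, [&& c x1 == 0, c x2 == 0 & c x3 != 0]].
  by exists c.
rewrite negb_exists => /forallP none; exfalso.
pose K (A : {set word p F}) x := [set c in A | c x == 0].
have KB (A : {set word p F}) x : (forall u v, u \in A -> v \in A -> u - v \in A) ->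
    (forall u v, u \in K A x -> v \in K A x -> u - v \in K A x).
  move=> AB u v; rewrite !inE => /andP[uA /eqP ux] /andP[vA /eqP vx].
  by rewrite AB // !ffunE ux vx subrr eqxx.
have Kcard (A : {set word p F}) x : (forall u v, u \in A -> v \in A -> u - v \in A) ->
    (#|A| <= p * #|K A x|)%N.
  move=> AB; apply: (card_additive_kernel p F p_pr A (fun c => c x)) => // u v.
  by rewrite !ffunE.
have CB u v : u \in C -> v \in C -> u - v \in C by apply: linear_codeB.
pose S := K (K C x1) x2.
have SB := KB _ x2 (KB _ x1 CB).
have S_ge : (p ^ 2 <= #|S|)%N.
  have cC : #|C| = (p ^ 4)%N by rewrite C_card e2.
  have h1 := Kcard _ x1 CB; have h2 := Kcard _ x2 (KB _ x1 CB).
  rewrite cC in h1; rewrite -/S in h2.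
  rewrite -(leq_pmul2l (m := p * p)) ?muln_gt0 ?p_gt0 // -[leqRHS]mulnA.
  rewrite (leq_trans _ (leq_mul (leqnn p) h2)) //.
  by apply: leq_trans h1; rewrite mulnn -expnD.
have S3 c : c \in S -> c x3 = 0.
  rewrite !inE => /andP[/andP[cC c1] c2]; apply/eqP.
  by have := none c; rewrite cC c1 c2 /= negbK.
have count : (\sum_(c in S) zeros p F c = \sum_(x : F) #|K S x|)%N.
  under eq_bigr do rewrite /zeros -sum1_card big_mkcond.
  rewrite exchange_big /=; apply: eq_bigr => x _; rewrite -sum1_card.
  rewrite -big_mkcondr /=; apply: eq_bigl => c; rewrite !inE.
  by [].
(* The zero word contributes all p^2 points, every other word at most p + 1. *)
have upper : (\sum_(c in S) zeros p F c <= p ^ 2 + (#|S| - 1) * p.+1)%N.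
  have S0 : zero_word p F \in S.
    by have [C0 _] := C_linear; rewrite !inE C0 !ffunE eqxx.
  rewrite (bigD1 (zero_word p F)) //= leq_add //.
    by have := wt_zeros p e F cardF (zero_word p F); rewrite e2; lia.
  have -> : (#|S| - 1 = #|S :\ zero_word p F|)%N.
    by rewrite [#|S|](cardsD1 (zero_word p F)) S0 add1n subn1.
  rewrite -sum_nat_const.
  rewrite [leqRHS](eq_bigl (fun c => (c \in S) && (c != zero_word p F))); last first.
    by move=> c; rewrite !inE andbC.
  apply: leq_sum => c /andP[]; rewrite !inE => /andP[/andP[cC _] _] c_nz.
  have := wt_zeros p e F cardF c; rewrite e2.
  have w_nz : wt p F c != 0%N by rewrite wt_eq0.
  have pp : (p.+1 <= p ^ 2)%N by rewrite -mulnn; nia.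
  case: (wt_plane c cC) => [w0|->|->|[/(_ sgn)[->|->] _]]; last 4 first.
  - by lia.
  - by lia.
  - by lia.
  - by lia.
  by rewrite w0 in w_nz.
(* All of S vanishes at the three points, and at least |S| / p of it at each other point; the factor
   p clears the denominator. *)
have lower : (3 * p * #|S| + (p ^ 2 - 3) * #|S| <= p * \sum_(x : F) #|K S x|)%N.
  pose X3 := x1 |: [set x2; x3].
  have X3card : #|X3| = 3%N.
    by rewrite /X3 cardsU1 cards2 !inE negb_or n12 n13 n23.
  rewrite (bigID (mem X3)) /= mulnDr leq_add //.
    rewrite (eq_bigr (fun=> #|S|)) ?sum_nat_const ?X3card.
      by rewrite mulnA [(p * 3)%N]mulnC.
    move=> x xX; apply: eq_card => c; rewrite [c \in K _ _]inE.
    have [cS|//] := boolP (c \in S); rewrite /= -[RHS]/true.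
    move: xX; rewrite !inE => /or3P[] /eqP ->.
    - by move: cS; rewrite !inE => /andP[/andP[]].
    - by move: cS; rewrite !inE => /andP[].
    by rewrite S3.
  have -> : (p ^ 2 - 3 = #|~: X3|)%N by rewrite [RHS]cardsCs setCK X3card cardF e2.
  rewrite big_distrr /= -sum_nat_const.
  rewrite [leqRHS](eq_bigl (mem (~: X3))) => [|x]; last by rewrite !inE.
  by apply: leq_sum => x _; apply: Kcard.
rewrite -count in lower; move: lower upper S_ge p_gt2.
move: (\sum_(c in S) _)%N #|S| => z s lo up sp p2.
have q2 : (9 <= p ^ 2)%N by rewrite -mulnn; nia.
have {}up : (p * z <= p * (p ^ 2 + (s - 1) * p.+1))%N by rewrite leq_mul2l up orbT.
have {up} lo := leq_trans lo up.
have s_gt0 : (0 < s)%N by lia.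
(* Cancelling s p (p + 1) leaves s (2p - 3) + p (p + 1) <= p^3, against s >= p^2 and 2p - 3 >= p. *)
have e1 : (p * (p ^ 2 + (s - 1) * p.+1) + p * p.+1 = p * p ^ 2 + s * (p * p.+1))%N.
  by rewrite -[in RHS](prednK s_gt0) subn1; ring.
have e3 : (3 * p * s + (p ^ 2 - 3) * s = s * (p * p.+1) + s * (2 * p - 3))%N.
  rewrite -mulnDl -mulnDr mulnC; congr (_ * _)%N.
  by rewrite mulnS -mulnn; lia.
have e4 : (p ^ 2 * (2 * p - 3) <= s * (2 * p - 3))%N by rewrite leq_mul2r sp orbT.
have e5 : (p ^ 2 * p <= p ^ 2 * (2 * p - 3))%N by rewrite leq_mul2l; lia.
have e6 : (0 < p * p.+1)%N by rewrite muln_gt0 p_gt0.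
rewrite e3 in lo; rewrite mulnC in e5; clear - lo e1 e4 e5 e6.
move: (p * p.+1)%N (p * p ^ 2)%N (s * (2 * p - 3))%N (p ^ 2 * (2 * p - 3))%N lo e1 e4 e5 e6.
by move=> A B D E; move: (s * A)%N (p * _)%N; lia.
Qed.

End Plane.

(** A dual word of weight 3, paired with a codeword vanishing at exactly two of its support points,
    would leave a single nonzero term. *)
Lemma dual_code_Cf_wt_ge4 v : e = 2%N -> eps * eta0 p (-1) = -1 ->
  v \in dualC -> v != zero_word p F -> (4 <= wt p F v)%N.
Proof.
move=> e2 sgn vD v_nz.
have := dual_code_Cf_wt_ge3 p e F f p_pr e_ge2 cardF v vD v_nz.
rewrite leq_eqVlt => /orP[/eqP w3|//]; exfalso.
have /card_gt2P[x1 [x2 [x3 [[x1S x2S x3S] [n12 n23 n31]]]]] : (2 < wt p F v)%N.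
  by rewrite -w3.
have sE : x1 |: [set x2; x3] = [set x | v x != 0].
  apply/eqP; rewrite eqEcard; apply/andP; split; last first.
    by rewrite -[leqLHS]/(wt p F v) -w3 cardsU1 cards2 !inE negb_or n12 n23 eq_sym n31.
  apply/subsetP => x; rewrite !inE => /or3P[] /eqP ->.
  - by move: x1S; rewrite inE.
  - by move: x2S; rewrite inE.
  by move: x3S; rewrite inE.
have [|c cC [c1 c2 c3]] := plane_no_dependent_triple e2 x1 x2 x3 sgn n12 _ n23.
  by rewrite eq_sym.
have /dual_codeP/(_ c cC) := vD; rewrite /dot (bigD1 x3) //= big1 => [|x nx].
  apply/eqP; rewrite addr0 mulf_neq0 //.
  by move: x3S; rewrite inE.
have [xS|] := boolP (x \in [set x | v x != 0]); last first.
  by rewrite inE negbK => /eqP ->; rewrite mulr0.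
move: xS; rewrite -sE !inE (negbTE nx) orbF => /orP[] /eqP ->; rewrite ?c1 ?c2 mul0r //.
Qed.

(** The weight bounds apply to f itself as a codeword and leave it at least two zeros, one of which
    is not 0. *)
Lemma bent_nontrivial_zero : ~ (e = 2%N /\ eps * eta0 p (-1) = -1) ->
  exists2 x, x != 0 & f x = 0.
Proof.
move=> not_plane.
pose t : 'F_p * F * 'F_p := (1, 0, 0).
have nz : t.1.1 != 0 by exact: oner_neq0.
have cwE x : cw t x = f x.
  by rewrite ffunE /= mul1r mul0r trace0 // !addr0.
have : (1 < zeros p F (cw t))%N.
  have := wt_zeros p e F cardF (cw t).
  have [e2|e_neq2] := eqVneq e 2%N.
    have sgn : eps * eta0 p (-1) = 1.
      have N1_nz : -1 != 0 :> 'F_p by rewrite oppr_eq0 oner_eq0.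
      case: (pm1_mul _ _ _ eps_pm (eta0_pm p _ N1_nz)) => // sgn.
      by case: not_plane.
    have le2 : (2 * p <= p ^ 2)%N by rewrite -mulnn leq_mul2r; lia.
    have := wt_range _ nz; rewrite e2.
    have := wt_plane e2 _ (codeword_in p e F f t); rewrite e2.
    by case=> [->|->|->|[_ /(_ sgn)[->|->]]]; lia.
  (* For e >= 3 the number of zeros is p^(e-1) + k p^m >= p^m >= p. *)
  have [m [k [m_le m_gt0 k_le wtE]]] := wt_int _ nz.
  have {}m_gt0 : (0 < m)%N by apply: m_gt0; lia.
  have le_pB : (p * p ^ m <= p ^ (e - 1))%N by rewrite -expnS leq_exp2l ?prime_gt1 //; lia.
  have B_ge : (p <= p ^ m)%N by rewrite -{1}[p]expn1 leq_exp2l // prime_gt1.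
  move: wtE; move: (wt _ _ _) (zeros _ _ _) (p ^ m)%N (p ^ (e - 1))%N (p ^ e)%N le_pB B_ge k_le.
  by move=> w z B A q; nia.
case/card_gt1P => x [y [xZ yZ xy]].
have [x0|x_nz] := eqVneq x 0.
  exists y; first by rewrite eq_sym -x0.
  by move: yZ; rewrite inE cwE => /eqP.
by exists x => //; move: xZ; rewrite inE cwE => /eqP.
Qed.

End BentDual.

(** * Assembly of parameters, weight distribution and duality *)

Theorem theorem4p2 (p e : nat) (F : finFieldType) (f : F -> 'F_p) (eps : algC) :
  prime p -> odd p -> (2 <= e)%N -> #|F| = (p ^ e)%N ->
  in_RF p e F f -> weakly_regular_bent p e F f eps ->
  let q := (p ^ e)%N in
  let C := code_Cf p e F f in
  let P : algC := p%:R in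
  let base : algC := P ^+ e - P ^+ (e - 1) in
  [/\ is_nk_code p F C q (e + 2),
      ~~ odd e ->
        [/\ freq p F C 0 = 1%N,
            freq p F C (base - eps * (P - 1) * sqrt_pstar p ^+ e / P)
              = ((p - 1) * p ^ e)%N,
            freq p F C (base + eps * sqrt_pstar p ^+ e / P)
              = ((p - 1) ^ 2 * p ^ e)%N,
            freq p F C base = (p * (p ^ e - 1))%N &
            freq p F C (P ^+ e) = (p - 1)%N /\
            forall c, c \in C -> (wt p F c)%:R \in
              [:: 0; base - eps * (P - 1) * sqrt_pstar p ^+ e / P;
                  base + eps * sqrt_pstar p ^+ e / P; base; P ^+ e]],
      odd e ->
        [/\ freq p F C 0 = 1%N,
            freq p F C (base - eps * sqrt_pstar p ^+ e * gauss_eta0 p / P)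
              = (((p - 1) ^ 2 * p ^ e) %/ 2)%N,
            freq p F C (base + eps * sqrt_pstar p ^+ e * gauss_eta0 p / P)
              = (((p - 1) ^ 2 * p ^ e) %/ 2)%N,
            freq p F C base = (2 * p ^ e.+1 - p ^ e - p)%N &
            freq p F C (P ^+ e) = (p - 1)%N /\
            forall c, c \in C -> (wt p F c)%:R \in
              [:: 0; base - eps * sqrt_pstar p ^+ e * gauss_eta0 p / P;
                  base + eps * sqrt_pstar p ^+ e * gauss_eta0 p / P; base; P ^+ e]],
      (3 <= e)%N -> C \subset dual_code p F C &
      ((e = 2%N /\ eps * eta0 p (-1) = -1) ->
        [/\ is_nkd_code p F (dual_code p F C) q (q - 4) 4,
            almost_MDS p F (dual_code p F C) &
            ~~ sphere_packing_ok p q (q - 4) 5]) /\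
      (~ (e = 2%N /\ eps * eta0 p (-1) = -1) ->
        is_nkd_code p F (dual_code p F C) q (q - e - 2) 3 /\
        ~~ sphere_packing_ok p q (q - e - 2) 5)].
Proof.
move=> p_pr p_odd e_ge2 cardF [_ [f0 [h [_ h_even _ f_homog]]]].
move=> [eps_pm [fstar walshE]] q C P base.
have wt_ge3 := dual_code_Cf_wt_ge3 p e F f p_pr e_ge2 cardF.
have dual_nk := dual_code_Cf_nk p e F f p_pr p_odd e_ge2 cardF eps fstar eps_pm walshE.
have sphere := sphere_packing_radius2 p e (odd_prime_gt2 p_odd p_pr) e_ge2.
split.
- exact: (code_Cf_nk p e F f p_pr p_odd e_ge2 cardF eps fstar).
- exact: (weight_distribution_even p e F f p_pr p_odd e_ge2 cardF eps fstar).
- exact: (weight_distribution_odd p e F f p_pr p_odd e_ge2 cardF eps fstar).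
- exact: (code_Cf_self_orthogonal p e F f p_pr p_odd e_ge2 cardF eps fstar).
split=> [[e2 sgn]|not_plane].
  have qE : (q - e - 2 = q - 4)%N by rewrite e2 -subnDA.
  rewrite -/q qE in dual_nk sphere.
  have nkd : is_nkd_code p F (dual_code p F C) q (q - 4) 4.
    have wt_ge4 v := dual_code_Cf_wt_ge4 p e F f p_pr p_odd e_ge2 cardF eps fstar eps_pm walshE
      v e2 sgn.
    split=> //; split=> //.
    have [v vD [v_nz v_le]] := dual_word4 p e F f p_pr p_odd e_ge2 cardF h f_homog h_even.
    by exists v => //; split=> //; apply/eqP; rewrite eqn_leq v_le wt_ge4.
  (* The almost MDS distance q - (q - 4) equals 4 because 4 <= q. *)
  split=> //; exists q, (q - 4)%N; rewrite subKn //.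
  rewrite /q e2; have := odd_prime_gt2 p_odd p_pr; rewrite -mulnn; nia.
split=> //; split=> //; split=> //.
have [x x_nz fx] :=
  bent_nontrivial_zero p e F f p_pr p_odd e_ge2 cardF eps fstar eps_pm walshE not_plane.
have [v vD [v_nz v_le]] :=
  dual_word3 p e F f p_pr p_odd e_ge2 cardF f0 h f_homog x x_nz fx.
by exists v => //; split=> //; apply/eqP; rewrite eqn_leq v_le wt_ge3.
Qed.
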